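(* Let $r \geq 3$ be an integer and let $\eta > 0$. Then there exist $n_0 \in \mathbb{N}$ and $\gamma > 0$ such that the following holds. Let $G$ be a graph on $n \geq n_0$ vertices where $r$ divides $n$ and where $$\delta(G) \geq \left(1 - \frac{1}{r+1} + \eta\right) n.$$ Given any function $f : E(G) \to \{-1, 1\}$, there exists a perfect $K_r$-tiling $\mathcal{T}$ in $G$ such that $$\left| \sum_{e \in E(\mathcal{T})} f(e) \right| \geq \gamma n.$$
   Context: All graphs are finite and simple. $E(G)$ is the edge set and $\delta(G)$ the minimum degree of $G$; $K_r$ is the complete graph on $r$ vertices. A perfect $K_r$-tiling in a graph $G$ is a collection $\mathcal{T}$ of vertex-disjoint copies of $K_r$ contained in $G$ (as subgraphs) that together cover every vertex of $G$. $E(\mathcal{T})$ denotes the set of all edges of $G$ lying in one of the copies of $K_r$ in $\mathcal{T}$. The constants $n_0$ and $\gamma$ depend only on $r$ and $\eta$. *)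

(* Defs.v *)
From mathcomp Require Import all_boot all_order all_algebra.

Set Implicit Arguments.
Unset Strict Implicit.
Unset Printing Implicit Defensive.

Record sgraph := SGraph {
  vertex :> finType;
  adj : rel vertex;
  adj_sym : symmetric adj;
  adj_irr : irreflexive adj }.

(* An edge is identified with the set of its two endpoints. *)
Definition edges (G : sgraph) : {set {set G}} :=
  [set [set x; y] | x in G, y in G & adj x y].

Definition degree (G : sgraph) (x : G) : nat := #|[set y : G | adj x y]|.

(* Every degree is smaller than #|G|, so the default value #|G| only plays a
   role for the graph without vertices, where the minimum degree is 0. *)
Definition min_degree (G : sgraph) : nat := \big[minn/#|G|]_(x : G) degree x.

Definition clique (G : sgraph) (K : {set G}) : bool :=
  [forall x in K, forall y in K, (x != y) ==> adj x y].

(* A copy of K_r in a simple graph is determined by its vertex set, so a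
   tiling is given as the set of the vertex sets of its copies of K_r. *)
Definition perfect_clique_tiling (G : sgraph) (r : nat)
    (T : {set {set G}}) : Prop :=
  partition T [set: G] /\ {in T, forall K : {set G}, #|K| = r /\ clique K}.

Definition tiling_edges (G : sgraph) (T : {set {set G}}) : {set {set G}} :=
  [set A in edges G | [exists K in T, A \subset K]].

(* A function E(G) -> {-1, 1}; its values outside E(G) are irrelevant. *)
Definition edge_labelling (G : sgraph) (f : {set G} -> int) : Prop :=
  {in edges G, forall A, f A = (-1)%R \/ f A = 1%R}.

(* Main.v *)
Require Import Defs.
From mathcomp Require Import all_boot all_order all_algebra.
From mathcomp Require Import reals.
From mathcomp Require Import zify ring lra.
Import Order.TTheory GRing.Theory Num.Theory.

Set Implicit Arguments.
Unset Strict Implicit.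
Unset Printing Implicit Defensive.

(** Write [n] for the number of vertices and [D] for [n] minus the minimum
    degree, so that [D <= n / r.+1 - eta * n].  Any [r.+1] vertices have a common
    neighbour outside any given set of fewer than [r.+1 * eta * n]
    vertices.

    Swaps.  Let [x] and [y] be distinct vertices and [A], [B] disjoint cliques of
    size [r.-1] in their common neighbourhood.  The [2 * r] vertices involved are
    tiled by the cliques [x |: A], [y |: B], and also by [y |: A], [x |: B].  Call
    this configuration a gadget if the two tilings have different label sums.
    Collect disjoint gadgets greedily.  If a small linear number of them is
    found, the vertices outside them are tiled by the Hajnal-Szemeredi theorem,
    whose degree condition has room to spare, and taking the heavier tiling of
    every gadget, or the lighter tiling of every gadget, gives two perfect
    tilings whose sums differ by a linear amount.  One of the two sums is far
    from zero.  See [gadget_tilings] and [disjoint_gadgets].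

    Rigidity.  Otherwise a small set [Z] meets every gadget.  Comparing cliques
    [A] that differ in one vertex shows that, outside [Z], the difference
    [f xc - f yc] is the same for all common neighbours [c] of [x] and [y]
    ([balanced]).  Hence [p u = f ua + f ub - f ab] does not depend on the
    triangle [u a b], and [2 * f uv = p u + p v] on every edge
    ([potential_edge]).  The values of [p] are odd and at most 3 in absolute
    value, and adjacent values add up to 2 or to -2; as any two vertices have a
    common neighbour, up to a global sign all values are -1 or 3
    ([common_side]).  Two vertices of value 3 are not adjacent, so there are at
    most [D < n / 4] of them.  The sum of a tiling of the complement of [Z] is
    [r.-1 / 2] times the sum of [p], which up to that sign is therefore negative
    and linear in [n] ([rigid_tiling_weight]).  A perfect tiling containing such a tiling has
    large discrepancy, because [Z] is small.

    The Hajnal-Szemeredi theorem is proved in its equivalent form on equitable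
    colourings ([hajnal_szemeredi]), applied to the complement graph, following
    the argument of Kierstead and Kostochka.  A colouring with one class too
    large and one class [a] too small is repaired by moving vertices along a
    path of classes towards [a], if there is one.  If there is none, counting
    the edges between the classes that reach [a] and the remaining classes
    finds a vertex whose exchange either splits the problem into two smaller
    ones or lets more classes reach [a]. *)

(** * Colourings with prescribed class sizes *)

(** Linear arithmetic on cardinals and truth values, regarded as arbitrary
    natural numbers. *)
Ltac card_lia :=
  repeat match goal with |- context [#|?X|] => generalize #|X| end;
  cbn [andb nat_of_bool];
  repeat match goal with
    |- context [nat_of_bool ?b] => generalize (nat_of_bool b) end;
  clear; lia.

Section Colourings.
Variables (V I : finType) (e : rel V).
Implicit Types (S : {set V}) (C A : {set I}) (c : V -> I) (s : nat).

Definition nbrs S x := [set y in S | e x y].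
Definition class c S i := [set x in S | c x == i].
Definition colouring S C c :=
  {in S, forall x, c x \in C} /\ {in S &, forall x y, e x y -> c x != c y}.
Definition equitable S C s c :=
  colouring S C c /\ {in C, forall i, #|class c S i| = s}.
(** The truth values say that class [a] lacks one vertex and class [b] has one
    too many.  Class sizes are compared in this additive form throughout, which
    avoids truncated subtraction. *)
Definition nearly_equitable S C s a b c :=
  [/\ colouring S C c, a \in C, b \in C, a != b &
      {in C, forall i, #|class c S i| + (i == a) = s + (i == b)}].
Definition movable c S x i := [forall y in class c S i, ~~ e x y].
Definition moves c S C i j :=
  [&& i \in C, j \in C, i != j & [exists x in class c S i, movable c S x j]].

Definition recolour c x j := fun v => if v == x then j else c v.

Lemma card_class c S i : #|class c S i| = \sum_(x in S) (c x == i).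
Proof.
rewrite -sum1_card big_mkcond [RHS]big_mkcond; apply: eq_bigr => x _.
by rewrite inE; case: (x \in S); case: (c x == i).
Qed.

Lemma card_class_recolour c S x i j : x \in S ->
  #|class (recolour c x j) S i| + (i == c x) = #|class c S i| + (i == j).
Proof.
move=> xS; rewrite !card_class (bigD1 x) //= [in RHS](bigD1 x) //=.
rewrite /recolour eqxx; under eq_bigr => v /andP[_ /negbTE ->] do [].
by rewrite [i == j]eq_sym [i == c x]eq_sym; lia.
Qed.

Hypothesis e_sym : symmetric e.
Hypothesis e_irr : irreflexive e.

Lemma colouring_recolour c S C x j : colouring S C c -> j \in C ->
  movable c S x j -> colouring S C (recolour c x j).
Proof.
move=> [cC cP] jC mv; have mvP v : v \in S -> c v = j -> ~~ e x v.
  by move=> vS cv; move/forall_inP: mv; apply; rewrite inE vS cv eqxx.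
split=> [v vS|u v uS vS euv]; rewrite /recolour.
  by case: eqP => // _; apply: cC.
case: (eqVneq u x) (eqVneq v x) => [ux|ux] [vx|vx]; last exact: cP.
- by move: euv; rewrite ux vx e_irr.
- apply: contraTneq euv => jv; rewrite ux; exact: mvP.
- by apply: contraTneq euv => jv; rewrite vx e_sym mvP.
Qed.

(** Every class on the path passes one vertex to the next class.  The moves are
    performed from the end of the path backwards: when a vertex enters class
    [j], that class has only lost vertices, so the move is still legal.  This
    is why the first class is tracked by an inclusion, and why the path must
    not repeat a class. *)
Lemma shift_along_path c S C i p : colouring S C c ->
    path (moves c S C) i p -> uniq (i :: p) ->
  exists c', [/\ colouring S C c',
    forall x, c x \notin i :: p -> c' x = c x,
    forall x, c x \in i :: p -> c' x \in i :: p,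
    class c' S i \subset class c S i &
    forall j, #|class c' S j| + (j == i) = #|class c S j| + (j == last i p)].
Proof.
move=> cCP; elim: p i => [|j p IHp] i; first by exists c; split.
move=> /= /andP[/and4P[iC jC ij /exists_inP[x]]]; rewrite inE.
move=> /andP[xS /eqP cx] mvx pP /andP[iNp Up].
have [c1 [c1P c1out c1in c1j c1size]] := IHp j pP Up.
have c1x : c1 x = i by rewrite c1out cx.
have mv1 : movable c1 S x j.
  apply/forall_inP => y y1; move/forall_inP: mvx; apply.
  exact: (subsetP c1j).
exists (recolour c1 x j); split.
- exact: colouring_recolour.
- move=> v; rewrite in_cons negb_or => /andP[vi vNp]; rewrite /recolour.
  by case: eqP => [vx|_]; [rewrite vx cx eqxx in vi | apply: c1out].
- move=> v vp; rewrite /recolour; case: eqP => [_|/eqP vx].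
    by rewrite in_cons mem_head orbT.
  case: (boolP (c v \in j :: p)) => [vjp|vNjp].
    by rewrite in_cons c1in ?orbT.
  by rewrite c1out.
- apply/subsetP => v; rewrite !inE /recolour; case: (v == x).
    by rewrite eq_sym (negbTE ij) andbF.
  case/andP=> -> /eqP c1v /=; rewrite -c1v c1out ?eqxx //.
  by apply: contra iNp => /c1in; rewrite c1v.
- by move=> l; rewrite -{1}c1x card_class_recolour // c1size.
Qed.

Definition rest c S A := [set x in S | c x \notin A].

Lemma in_rest c S A x : (x \in rest c S A) = (x \in S) && (c x \notin A).
Proof. by rewrite inE. Qed.

Lemma in_class c S i x : (x \in class c S i) = (x \in S) && (c x == i).
Proof. by rewrite inE. Qed.

Lemma card_nbrs_split c S A x :
  #|nbrs S x| = \sum_(i in A) #|nbrs (class c S i) x| + #|nbrs (rest c S A) x|.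
Proof.
rewrite -(cardsID [set y | c y \in A] (nbrs S x)); congr (_ + _); last first.
  congr #|pred_of_set _|; apply/setP=> y; rewrite !inE.
  by case: (y \in S); rewrite ?andbF //= andbC.
rewrite -sum1_card (partition_big c (mem A)) /=; last first.
  by move=> y; rewrite !inE => /andP[_ ->].
apply: eq_bigr => i iA; rewrite -sum1_card; apply: eq_bigl => y; rewrite !inE.
by case: eqP => [->|_]; rewrite ?iA ?andbF ?andbT.
Qed.

Lemma unmovable_nbrs_gt0 c S x i : ~~ movable c S x i -> 0 < #|nbrs (class c S i) x|.
Proof.
rewrite negb_forall_in => /exists_inP[y yi exy]; rewrite card_gt0.
by apply/set0Pn; exists y; rewrite !inE; move: yi exy; rewrite inE negbK => ->.
Qed.

(** A vertex that cannot move to a class has a neighbour in it.  All degree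
    estimates below come from this count. *)
Lemma unmovable_degree c S A A0 x : A0 \subset A ->
  {in A0, forall i, ~~ movable c S x i} ->
  #|A0| + #|nbrs (rest c S A) x| <= #|nbrs S x|.
Proof.
move=> A0A nm; rewrite (card_nbrs_split c S A) leq_add2r.
rewrite -sum1_card [X in X <= _]big_mkcond [X in _ <= X]big_mkcond.
apply: leq_sum => i _; case: ifP => // iA0; rewrite (subsetP A0A) //.
by apply: unmovable_nbrs_gt0; apply: nm.
Qed.

End Colourings.

(** * Terminal blocks in a directed graph *)

Section Reachability.
Variables (I : finType) (H : rel I) (a : I).

Definition avoid W := [rel i j | [&& H i j, i != W & j != W]].
Definition cut_off U :=
  [set i | [&& connect H i a, i != U & ~~ connect (avoid U) i a]].

Lemma avoid_path W i : connect (avoid W) i a -> i != W ->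
  exists p, [/\ path H i p, uniq (i :: p), last i p = a & W \notin i :: p].
Proof.
case/connectP=> p0 /shortenP[p pP Up _] -> iW; exists p; split=> //.
  by apply: sub_path pP => x y /and3P[].
elim: p i iW pP {Up} => [|j p IHp] i iW /=; first by rewrite inE eq_sym iW.
by case/andP=> /and3P[_ _ jW] pP; rewrite in_cons negb_or eq_sym iW IHp.
Qed.

(** A path to [a] in the graph without [U] stays among the vertices that reach
    [a] without [U], so it never visits a vertex cut off by [U]. *)
Lemma connect_avoid U W i : W \in cut_off U -> i != U ->
  connect (avoid U) i a -> connect (avoid W) i a.
Proof.
rewrite inE => /and3P[_ WU WNa] iU /connectP[p pP aE].
elim: p i iU pP aE => [|j p IHp] i iU /=; first by move=> _ ->.
case/andP=> ij pP aE; have /and3P[Hij _ jU] := ij.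
have ja : connect (avoid U) j a by apply/connectP; exists p.
apply: connect_trans (IHp j jU pP aE); apply: connect1; apply/and3P.
split=> //; apply: contraNneq WNa => <-.
  apply: (connect_trans (y := j)) => //; exact: (@connect1 _ (avoid U) i j ij).
exact: ja.
Qed.

(** Choose [U] cutting off the smallest nonempty set [T].  If some [W] in [T] cut
    off anything, that set would be strictly contained in [T]: what survives the
    deletion of [U], and [U] itself, reaches [a] without visiting [T].  So no
    vertex of [T] cuts off anything.  An arc from [T] to a vertex outside
    [T] that reaches [a] and is not [U] would lead on to [a] without [U]. *)
Lemma terminal_block b : connect H b a -> b != a ->
  exists U (T : {set I}), [/\ connect H U a, U \notin T, T != set0 &
    forall W, W \in T -> [/\ connect H W a, W != a,
      forall j, connect H j a -> j != W -> connect (avoid W) j a &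
      forall j, connect H j a -> j != U -> j \notin T -> ~~ H W j]].
Proof.
move=> ba bNa.
have cut0 : connect H a a && (cut_off a != set0).
  rewrite connect0; apply/set0Pn; exists b; rewrite inE ba bNa /=.
  apply/negP=> /avoid_path[] // p [_ _ <-].
  by rewrite mem_last.
pose P U := connect H U a && (cut_off U != set0).
case: (@arg_minnP _ a P (fun U => #|cut_off U|) cut0) => U /andP[Ua UT] minU.
exists U, (cut_off U); split=> //; first by rewrite inE eqxx andbF.
move=> W WT; have := WT; rewrite inE => /and3P[Wa WU WNa].
split=> //.
- by apply: contraNneq WNa => ->.
- move=> j ja jW; apply/negPn/negP => jNa.
  have jT : j \in cut_off W by rewrite inE ja jW.
  have PW : P W by rewrite /P Wa; apply/set0Pn; exists j.
  have := minU W PW; apply/negP; rewrite -ltnNge; apply: proper_card.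
  apply/properP; split; last first.
    by exists W => //; rewrite inE eqxx andbF.
  apply/subsetP=> i; rewrite !inE => /and3P[-> iW /= iNa].
  have iU : i != U; last first.
    by rewrite iU; apply: contra iNa => /(connect_avoid WT iU).
  apply: contraNneq iNa => ->.
  case/connectP: Ua => p0 /shortenP[[|k p] pP Up _] aE.
    by rewrite [X in connect _ _ X]aE.
  case/andP: pP => /= HUk pP; case/andP: Up => UNp Up.
  have kU : k != U.
    by apply: contraNneq UNp => ->; rewrite mem_head.
  have ka : connect (avoid U) k a.
    apply/connectP; exists p => //.
    elim: p k UNp kU pP {aE Up HUk} => //= l p IHp k UNp kU /andP[Hkl pP].
    move: UNp; rewrite !in_cons !negb_or => /and3P[_ Ul Up].
    rewrite Hkl kU eq_sym Ul IHp //; last by rewrite eq_sym.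
    by rewrite in_cons negb_or Ul.
  apply: connect_trans (connect_avoid WT kU ka); apply: connect1.
  rewrite /= HUk eq_sym WU; apply: contraNneq WNa => <-.
  exact: ka.
- move=> j ja jU; rewrite inE ja jU negbK /= => ja'; apply/negP=> HWj.
  case/negP: WNa; apply: connect_trans ja'; apply: connect1.
  by rewrite /= HWj WU.
Qed.

End Reachability.

(** * Solo neighbours in a nearly equitable colouring *)

Lemma sum_card_nbrs_exchange (V : finType) (e : rel V) (X Y : {set V}) :
  symmetric e ->
  \sum_(y in Y) #|nbrs e X y| = \sum_(x in X) #|nbrs e Y x|.
Proof.
move=> e_sym; under eq_bigr do rewrite -sum1_card.
under [RHS]eq_bigr do rewrite -sum1_card.
rewrite (exchange_big_dep (mem X)) /=; last first.
  by move=> y x _; rewrite inE => /andP[].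
by apply: eq_bigr => x xX; apply: eq_bigl => y; rewrite !inE xX /= e_sym.
Qed.

(** A maximal independent set dominates: the closed neighbourhoods of its
    vertices cover [B]. *)
Lemma dominating_independent_set (V : finType) (e : rel V) (B : {set V}) :
  symmetric e -> irreflexive e ->
  exists J : {set V}, [/\ J \subset B, {in J &, forall x y, ~~ e x y} &
    #|B| <= \sum_(y in J) #|nbrs e B y|.+1].
Proof.
move=> e_sym e_irr.
pose indep (J : {set V}) :=
  (J \subset B) && [forall x in J, forall y in J, ~~ e x y].
have indep0 : indep set0.
  by rewrite /indep sub0set; apply/forall_inP => x; rewrite inE.
have [J /maxsetP[/andP[JB /forall_inP J_indep] J_max] _] :=
  maxset_exists indep0.
have {}J_indep : {in J &, forall x y, ~~ e x y}.
  by move=> x y xJ yJ; move/forall_inP: (J_indep x xJ); apply.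
exists J; split=> //.
apply: leq_trans (_ : #|\bigcup_(y in J) (y |: nbrs e B y)| <= _).
  apply/subset_leq_card/subsetP => v vB; apply/bigcupP.
  case: (boolP (v \in J)) => [vJ|vNJ]; first by exists v; rewrite ?setU11.
  have [/exists_inP[y yJ evy]|noe] := boolP [exists y in J, e v y].
    by exists y; rewrite ?inE // vB e_sym evy orbT.
  case/negP: vNJ; rewrite -(J_max (v |: J)) ?setU11 ?subsetUr //.
  have nv y : y \in J -> ~~ e v y.
    by move=> yJ; apply: contra noe => evy; apply/exists_inP; exists y.
  rewrite /indep subUset sub1set vB JB /=; apply/forall_inP => x.
  rewrite !inE => /orP[/eqP->|xJ]; apply/forall_inP => y; rewrite !inE.
    by case/orP => [/eqP->|]; [rewrite e_irr | apply: nv].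
  by case/orP => [/eqP->|yJ]; [rewrite e_sym nv | apply: J_indep].
elim/big_ind2: _ => [|A m A' m' Am Am'|y yJ]; first by rewrite cards0.
  by apply: leq_trans (leq_add Am Am'); rewrite cardsU leq_subr.
by rewrite cardsU1 inE e_irr andbF add1n.
Qed.

Section SoloVertices.
Variables (V I : finType) (e : rel V).
Hypothesis e_sym : symmetric e.
Hypothesis e_irr : irreflexive e.
Variables (S : {set V}) (C : {set I}) (s : nat) (a b : I) (c : V -> I).
Hypothesis c_near : nearly_equitable e S C s a b c.
Hypothesis deg_lt : {in S, forall x, #|nbrs e S x| < #|C|}.

Let H := moves e c S C.
Definition accessible := [set i in C | connect H i a].
Let A := accessible.
Let B := rest c S A.
Hypothesis b_inaccessible : b \notin A.
Let q := #|C :\: A|.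

Let c_col : colouring e S C c. Proof. by case: c_near. Qed.

Lemma accessibleP i : (i \in A) = connect H i a.
Proof.
rewrite inE; case: (boolP (connect H i a)) => [/connectP[[|j p]]|]; rewrite ?andbF //=.
  by move=> _ <-; case: c_near => _ ->.
by case/andP=> /and4P[->].
Qed.

Lemma accessible_sub : A \subset C.
Proof. by apply/subsetP => i; rewrite inE => /andP[]. Qed.

Lemma unmovable_class i j x : i \in C -> j \in C -> i != j -> ~~ H i j ->
  x \in class c S i -> ~~ movable e c S x j.
Proof.
move=> iC jC ij; rewrite /H /moves iC jC ij /= => nm xi.
by apply: contra nm => mv; apply/exists_inP; exists x.
Qed.

Lemma unmovable_rest y i : y \in B -> i \in A -> ~~ movable e c S y i.
Proof.
rewrite inE => /andP[yS cyNA] iA; have cyC : c y \in C by apply c_col.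
have iC : i \in C by apply: subsetP iA; apply: accessible_sub.
apply: (@unmovable_class (c y)) => //; last by rewrite inE yS eqxx.
  by apply: contraNneq cyNA => ->.
apply: contra cyNA => Hyi; move: iA; rewrite !accessibleP.
by apply: connect_trans; apply: connect1.
Qed.

Lemma card_accessible : #|A| + q = #|C|.
Proof. by rewrite /q -(cardsID A C) (setIidPr accessible_sub). Qed.

(** The oversized class [b] is among the inaccessible ones, whereas the
    undersized class [a] is not. *)
Lemma card_rest : #|B| = q * s + 1.
Proof.
case: c_near => _ aC bC _ sizes.
have bCA : b \in C :\: A by rewrite inE b_inaccessible.
have -> : #|B| = \sum_(i in C :\: A) #|class c S i|.
  rewrite -sum1_card (partition_big c (mem (C :\: A))) /=; last first.
    by move=> y; rewrite !inE => /andP[yS ->]; rewrite andTb; apply c_col.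
  apply: eq_bigr => i; rewrite in_setD => /andP[iNA _].
  rewrite -sum1_card; apply: eq_bigl => y.
  rewrite in_rest in_class.
  by case: eqP => [->|_]; rewrite ?andbF // iNA !andbT.
rewrite (bigD1 b) //= (eq_bigr (fun=> s)) => [|i /andP[]]; last first.
  rewrite inE => /andP[iNA iC] ib; have := sizes i iC.
  rewrite (negbTE ib); case: eqP => [ia|_]; last by rewrite !addn0.
  by move: iNA; rewrite accessibleP ia connect0.
have := sizes b bC; rewrite eqxx; case: eqP => [ba|_].
  by move: b_inaccessible; rewrite accessibleP ba connect0.
rewrite addn0 => ->; rewrite sum_nat_const; have := cardD1 b (C :\: A).
rewrite bCA -/q => qE; set n1 := #|_|; have -> : q = n1.+1; last by lia.
rewrite qE add1n; congr _.+1; apply: eq_card => i.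
by rewrite !unfold_in /= andbC.
Qed.

Lemma card_class_accessible i : i \in A -> i != a -> #|class c S i| = s.
Proof.
case: c_near => _ _ _ _ sizes iA /negbTE ia.
have := sizes i (subsetP accessible_sub i iA); rewrite ia.
case: eqP => [ib|_]; last by rewrite !addn0.
by move: b_inaccessible; rewrite -ib iA.
Qed.

(** A vertex of [B] has a neighbour in each accessible class, so the degree left
    inside [B] is what an equitable colouring of [B] minus one vertex by the
    inaccessible colours needs. *)
Lemma card_nbrs_rest y : y \in B -> #|nbrs e B y| < q.
Proof.
move=> yB; have yS : y \in S by move: yB; rewrite inE => /andP[].
have := unmovable_degree (subxx A) (fun i iA => unmovable_rest yB iA).
by have := deg_lt yS; rewrite -/B -card_accessible; lia.
Qed.

(** If only [a] were accessible, every vertex of [B] would have a neighbour in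
    the undersized class [a], whose [s.-1] vertices cannot have that many
    neighbours. *)
Lemma exists_accessible : exists2 i, i \in A & i != a.
Proof.
have [A0|[i]] := set_0Vmem (A :\ a); last first.
  by rewrite !inE -/A => /andP[ia iA]; exists i => //; rewrite inE.
exfalso.
have aA : a \in A by rewrite accessibleP connect0.
have cardA : #|A| = 1.
  by rewrite (cardsD1 a) aA A0 cards0.
have le1 : #|B| <= \sum_(y in B) #|nbrs e (class c S a) y|.
  rewrite -sum1_card; apply: leq_sum => y yB.
  by apply: unmovable_nbrs_gt0; apply: unmovable_rest.
have le2 : \sum_(x in class c S a) #|nbrs e B x| <= #|class c S a| * q.
  rewrite -sum_nat_const; apply: leq_sum => x; rewrite inE => /andP[xS _].
  have := deg_lt xS; rewrite -card_accessible cardA add1n ltnS.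
  apply: leq_trans; apply: subset_leq_card; apply/subsetP => v.
  by rewrite !inE => /andP[/andP[->]].
case: c_near => _ aC _ ab /(_ a aC); rewrite eqxx (negbTE ab) addn0 addn1 => sE.
move: le1; rewrite sum_card_nbrs_exchange // => /leq_trans/(_ le2).
by rewrite card_rest; nia.
Qed.

(** A vertex [z] of class [W] is the solo neighbour of [y] when it is the only
    neighbour of [y] in that class: exchanging [y] for [z] keeps [W] independent.
    The block [T] below is the one given by [terminal_block], and no solo vertex
    of its classes can move to another accessible class. *)
Section Block.
Variables (U : I) (T : {set I}).
Hypothesis UA : U \in A.
Hypothesis UT : U \notin T.
Hypothesis T0 : T != set0.
Hypothesis TA : T \subset A.
Hypothesis aT : a \notin T.
Hypothesis T_closed :
  {in T, forall W, {in A, forall j, j != U -> j \notin T -> ~~ H W j}}.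
Hypothesis solo_unmovable :
  forall W y z X, W \in T -> y \in B -> nbrs e (class c S W) y = [set z] ->
  X \in A -> X != W -> ~~ movable e c S z X.

Lemma card_class_block W : W \in T -> #|class c S W| = s.
Proof.
move=> WT; apply: card_class_accessible; first exact: subsetP WT.
by apply: contraNneq aT => <-.
Qed.

Lemma card_nbrs_block W x :
  W \in T -> x \in class c S W -> #|nbrs e B x| <= q + #|T|.
Proof.
move=> WT xW; have xS : x \in S by move: xW; rewrite inE => /andP[].
have WA : W \in A by apply: subsetP WT.
have sub0 : A :\ U :\: T \subset A.
  by apply/subsetP => i; rewrite !inE => /and3P[].
have nm i : i \in A :\ U :\: T -> ~~ movable e c S x i.
  rewrite in_setD in_setD1 => /and3P[iT iU iA].
  apply: (@unmovable_class W) => //; try exact: (subsetP accessible_sub).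
    by apply: contraNneq iT => <-.
  exact: T_closed.
have := unmovable_degree sub0 nm; have := deg_lt xS; rewrite -/B -card_accessible.
have := cardsD1 U A; rewrite UA.
have := cardsID T (A :\ U); rewrite (setIidPr _); first by card_lia.
by rewrite subsetD1 TA UT.
Qed.

Lemma card_nbrs_solo W y z :
  W \in T -> y \in B -> nbrs e (class c S W) y = [set z] -> #|nbrs e B z| <= q.
Proof.
move=> WT yB solo; have zS : z \in S.
  by have := set11 z; rewrite -solo !inE => /andP[/andP[]].
have WA : W \in A by apply: subsetP WT.
have nm i : i \in A :\ W -> ~~ movable e c S z i.
  by rewrite in_setD1 => /andP[iW iA]; apply: (solo_unmovable WT yB solo).
have := unmovable_degree (subsetDl A [set W]) nm.
by have := deg_lt zS; rewrite -/B -card_accessible (cardsD1 W A) WA; lia.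
Qed.

(** Count the edges between [B] and one class [W] of the block, giving weight 2
    to the edges at solo vertices.  Every vertex of [B] receives weight at least
    2, whereas a vertex of [W] sends at most [q * 2] if the block has at most [q]
    classes.  This contradicts that [B] has more than [q * s] vertices. *)
Lemma card_block_gt : q < #|T|.
Proof.
rewrite ltnNge; apply/negP => tq; have [W WT] := set0Pn _ T0.
pose wt z := if [exists y in B, nbrs e (class c S W) y == [set z]] then 2 else 1.
have ge2 y : y \in B -> 2 <= \sum_(z in nbrs e (class c S W) y) wt z.
  move=> yB; have gt0 : 0 < #|nbrs e (class c S W) y|.
    by apply: unmovable_nbrs_gt0; apply: unmovable_rest => //; apply: subsetP WT.
  have [le1|gt1] := leqP #|nbrs e (class c S W) y| 1.
    have /cards1P[z zE] : #|nbrs e (class c S W) y| == 1 by rewrite eqn_leq le1.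
    rewrite zE big_set1 /wt; case: exists_inP => // -[].
    by exists y => //; rewrite zE.
  apply: leq_trans gt1 _; rewrite -sum1_card; apply: leq_sum => z _.
  by rewrite /wt; case: ifP.
have : \sum_(y in B) 2 <= \sum_(y in B) \sum_(z in nbrs e (class c S W) y) wt z.
  exact: leq_sum.
rewrite sum_nat_const card_rest (exchange_big_dep (mem (class c S W))) /=; last first.
  by move=> y z _; rewrite inE => /andP[].
apply/negP; rewrite -ltnNge.
apply: leq_ltn_trans (_ : \sum_(z in class c S W) q * 2 < _); last first.
  by rewrite sum_nat_const card_class_block //; nia.
apply: leq_sum => z zW; rewrite sum_nat_const mulnC.
have -> : #|[pred y in B | z \in nbrs e (class c S W) y]| = #|nbrs e B z|.
  by apply: eq_card => y; rewrite !inE e_sym; move: zW; rewrite inE => ->.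
rewrite /wt; case: exists_inP => [[y yB /eqP solo]|_].
  by have := card_nbrs_solo WT yB solo; lia.
by have := card_nbrs_block WT zW; lia.
Qed.

Let solos y := [set W in T | #|nbrs e (class c S W) y| == 1].

(** Each class of the block in which [y] is not solo costs [y] a second
    neighbour, and the degree of [y] is bounded. *)
Lemma card_solos y : y \in B -> #|nbrs e B y| + #|T| + 1 <= #|solos y| + q.
Proof.
move=> yB; have yS : y \in S by move: yB; rewrite inE => /andP[].
have := deg_lt yS; rewrite (card_nbrs_split e c S A) -card_accessible -/B.
suff : #|A| + #|T| <= \sum_(i in A) #|nbrs e (class c S i) y| + #|solos y| by lia.
have cardE (D : {set I}) : D \subset A -> #|D| = \sum_(i in A) (i \in D).
  move=> DA; rewrite -sum1_card [RHS]big_mkcond [LHS]big_mkcond.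
  apply: eq_bigr => i _; case: ifP => [/(subsetP DA)->|] //.
  by rewrite if_same.
rewrite (cardE T) // (cardE (solos y)); last first.
  by apply: subset_trans TA; apply/subsetP => i; rewrite inE => /andP[].
rewrite -sum1_card -!big_split /=; apply: leq_sum => i iA.
have := unmovable_nbrs_gt0 (unmovable_rest yB iA); rewrite inE.
by case: (i \in T) => /=; lia.
Qed.

(** Sum [card_solos] over a dominating independent set [J] of [B].  Since
    [#|T| > q] and [J] has more than [s] vertices, there are more than [#|T| * s]
    solo incidences, that is, more than vertices in the block.  So two vertices
    of [J] share their solo neighbour. *)
Lemma nonadjacent_solo_pair : exists W z y1 y2,
  [/\ W \in T, y1 \in B, y2 \in B & y1 != y2] /\
  [/\ ~~ e y1 y2, nbrs e (class c S W) y1 = [set z] &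
      nbrs e (class c S W) y2 = [set z]].
Proof.
have [J [JB J_indep le1]] := dominating_independent_set B e_sym e_irr.
have le2 : \sum_(y in J) #|nbrs e B y|.+1 + #|J| * #|T| <=
    \sum_(y in J) #|solos y| + #|J| * q.
  rewrite -!sum_nat_const -!big_split /=; apply: leq_sum => y yJ.
  by have := card_solos (subsetP JB y yJ); lia.
have le3 : \sum_(y in J) #|nbrs e B y|.+1 <= #|J| * q.
  rewrite -sum_nat_const; apply: leq_sum => y yJ.
  exact/card_nbrs_rest/(subsetP JB).
have sum_gt : #|T| * s < \sum_(y in J) #|solos y|.
  move: le1 le2 le3; rewrite card_rest; have := card_block_gt; nia.
pose JW W := [set y in J | #|nbrs e (class c S W) y| == 1].
have /exists_inP[W WT gtW] : [exists W in T, s < #|JW W|].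
  apply: contraLR sum_gt; rewrite negb_exists_in => /forall_inP le_s.
  rewrite -leqNgt -sum_nat_const.
  under eq_bigr do rewrite -sum1_card.
  rewrite (exchange_big_dep (mem T)) /=; last first.
    by move=> y W _; rewrite inE => /andP[].
  apply: leq_sum => W WT; have := le_s W WT; rewrite -leqNgt; apply: leq_trans.
  rewrite -sum1_card; apply: eq_leq; apply: eq_bigl => y.
  by rewrite !inE WT.
pose g y := odflt y [pick z in nbrs e (class c S W) y].
have gP y : y \in JW W -> nbrs e (class c S W) y = [set g y].
  rewrite inE => /andP[_ /cards1P[z zE]]; rewrite /g zE; case: pickP => [x|].
    by rewrite inE => /eqP ->.
  by move/(_ z); rewrite set11.
have /dinjectivePn[y1 y1J [y2]] : ~~ dinjectiveb g (mem (JW W)).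
  apply: contraL gtW => /dinjectiveP g_inj.
  rewrite -leqNgt -(card_class_block WT) -(card_in_imset g_inj).
  apply/subset_leq_card/subsetP => _ /imsetP[y yJ ->].
  have : g y \in nbrs e (class c S W) y by rewrite gP ?set11.
  by rewrite inE => /andP[].
rewrite !inE => /andP[y21 y2J] g12; exists W, (g y1), y1, y2.
have y2JW : y2 \in JW W by rewrite inE.
have inJ y : y \in JW W -> y \in J by rewrite inE => /andP[].
split; first by rewrite eq_sym; split=> //; apply: (subsetP JB); apply: inJ.
by split; [apply: J_indep; apply: inJ | apply: gP | rewrite g12; apply: gP].
Qed.

End Block.
End SoloVertices.

(** * The Hajnal-Szemeredi theorem *)

Section Exchange.
Variables (V I : finType) (e : rel V).
Hypothesis e_sym : symmetric e.
Hypothesis e_irr : irreflexive e.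
Variables (S : {set V}) (C : {set I}) (s : nat).
Hypothesis deg_lt : {in S, forall x, #|nbrs e S x| < #|C|}.
Hypothesis smaller : forall (S' : {set V}) (C' : {set I}),
  S' \proper S -> #|S'| = #|C'| * s ->
  {in S', forall x, #|nbrs e S' x| < #|C'|} ->
  exists c, equitable e S' C' s c.

Definition paste (B : {set V}) (c2 c1 : V -> I) v := if v \in B then c2 v else c1 v.

(** When [c2] avoids the colours in [A] on [B], and [c1] uses only colours in [A]
    on the rest of [S], every class of the pasted colouring comes from one of
    the two colourings alone. *)
Lemma class_paste_in (A : {set I}) (B : {set V}) c2 c1 i :
  {in S, forall v, (v \in B) = (c1 v \notin A)} ->
  {in B, forall v, c2 v \notin A} -> i \in A ->
  class (paste B c2 c1) S i = class c1 S i.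
Proof.
move=> BE c2A iA; apply/setP => v; rewrite !in_class /paste.
case: (boolP (v \in S)) => //= vS; case: (boolP (v \in B)) => // vB.
have := c2A v vB; have := BE v vS; rewrite vB => /esym.
case: eqP => [->|_]; first by rewrite iA.
by case: eqP => // ->; rewrite iA.
Qed.

Lemma class_paste_out (A : {set I}) (B : {set V}) c2 c1 i : B \subset S ->
  {in S, forall v, (v \in B) = (c1 v \notin A)} -> i \notin A ->
  class (paste B c2 c1) S i = class c2 B i.
Proof.
move=> BS BE iA; apply/setP => v; rewrite !in_class /paste.
case: (boolP (v \in B)) => [/(subsetP BS)->|vB] //=.
case: (boolP (v \in S)) => //= vS; apply/eqP => c1v.
by move: vB; rewrite BE // c1v iA.
Qed.

Section Step.
Variables (a b : I) (c : V -> I).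
Hypothesis c_near : nearly_equitable e S C s a b c.
Let H := moves e c S C.
Let A := accessible e S C a c.
Let B := rest c S A.
Hypothesis b_inaccessible : b \notin A.
Variables (W : I) (z : V).
Hypothesis WA : W \in A.
Hypothesis zW : z \in class c S W.
Hypothesis W_terminal : {in A, forall j, j != W -> connect (avoid H W) j a}.

Let c_col : colouring e S C c. Proof. by case: c_near. Qed.
Let AC : A \subset C. Proof. exact: accessible_sub. Qed.
Let zS : z \in S. Proof. by move: zW; rewrite in_class => /andP[]. Qed.
Let cz : c z = W. Proof. by move: zW; rewrite in_class => /andP[_ /eqP]. Qed.

Let BS : B \subset S.
Proof. by apply/subsetP => v; rewrite in_rest => /andP[]. Qed.

Lemma equitable_rest y : y \in B ->
  exists c2, equitable e (B :\ y) (C :\: A) s c2.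
Proof.
move=> yB; have yS : y \in S by apply: subsetP yB.
have cardB := card_rest c_near b_inaccessible.
have := cardsD1 y B; rewrite yB => cardBy.
apply: smaller.
- exact: proper_sub_trans (properD1 yB) BS.
- by move: cardB cardBy; rewrite -/A -/B; card_lia.
- move=> v; rewrite in_setD1 => /andP[vy vB].
  have := card_nbrs_rest c_near deg_lt b_inaccessible vB; apply: leq_ltn_trans.
  by apply/subset_leq_card/subsetP => u; rewrite !inE => /andP[/andP[_ ->] ->].
Qed.

Lemma path_accessible i p : path H i p -> last i p = a -> {subset i :: p <= A}.
Proof.
elim: p i => [|j p IHp] i /=; last first.
  case/andP=> Hij pP aE k; rewrite in_cons => /orP[/eqP ->|kp].
    have jA := IHp j pP aE j (mem_head j p); move: jA.
    by rewrite !(accessibleP c_near); exact/connect_trans/connect1.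
  exact: IHp pP aE k kp.
by move=> _ -> k; rewrite inE => /eqP ->; rewrite (accessibleP c_near) connect0.
Qed.

(** Move [z] to [X], put [y] in its place, and pass the surplus of [X] on to [a]
    by a path avoiding [W].  The accessible classes then have size [s], and the
    remaining vertices are recoloured by the smaller instance. *)
Lemma equitable_of_movable_solo X y : X \in A -> X != W ->
  movable e c S z X -> y \in B -> nbrs e (class c S W) y = [set z] ->
  exists c', equitable e S C s c'.
Proof.
move=> XA XW mvz yB solo.
have [p [pP Up pa WNp]] := avoid_path (W_terminal XA XW) XW.
have [c' [c'P c'out c'in c'X c'size]] := shift_along_path e_sym e_irr c_col pP Up.
have pA := path_accessible pP pa.
have [yS cyNA] : y \in S /\ c y \notin A by apply/andP; rewrite -in_rest.
have XC := subsetP AC X XA; have WC := subsetP AC W WA.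
have c'A v : (c' v \in A) = (c v \in A).
  case: (boolP (c v \in X :: p)) => [vp|vNp]; last by rewrite c'out.
  by rewrite !pA // c'in.
have c'z : c' z = W by rewrite c'out cz.
have yz : y != z by apply: contraNneq cyNA => ->; rewrite cz.
have classW v : v \in S -> c' v = W -> v \in class c S W.
  move=> vS c'v; rewrite in_class vS; apply/eqP.
  case: (boolP (c v \in X :: p)) => [vp|vNp]; last by rewrite -c'out.
  by move: WNp; rewrite -c'v c'in.
pose c1 := recolour c' z X; pose c3 := recolour c1 y W.
have c1P : colouring e S C c1.
  apply: colouring_recolour => //; apply/forall_inP => v vX.
  by move/forall_inP: mvz; apply; apply: subsetP vX.
have c3P : colouring e S C c3.
  apply: colouring_recolour => //; apply/forall_inP => v; rewrite in_class.
  case/andP=> vS; rewrite /c1 /recolour; case: (eqVneq v z) => [_|vz /eqP c'v].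
    by rewrite (negbTE XW).
  have := classW v vS c'v => vW; apply: contraNN vz => eyv.
  by rewrite -in_set1 -solo inE vW.
have cb i : i \in A -> (i == b) = false.
  by move=> iA; apply: contraNF b_inaccessible => /eqP <-.
have c3size i : i \in A -> #|class c3 S i| = s.
  move=> iA; have yi : (i == c1 y) = false.
    rewrite /c1 /recolour (negbTE yz); apply: contraNF cyNA => /eqP iE.
    by rewrite -c'A -iE.
  have := card_class_recolour c1 i W yS; rewrite yi.
  have := card_class_recolour c' i X zS; rewrite c'z.
  have := c'size i; rewrite pa; case: c_near => _ _ _ _ /(_ i (subsetP AC i iA)).
  rewrite cb // -/c1 -/c3.
  card_lia.
have BE : {in S, forall v, (v \in B :\ y) = (c3 v \notin A)}.
  move=> v vS; rewrite in_setD1 in_rest vS /c3 /c1 /recolour.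
  case: eqP => [_|_] /=; first by rewrite WA.
  case: eqP => [->|_]; first by rewrite cz WA XA.
  by rewrite c'A.
have [c2 [[c2C c2P] c2size]] := equitable_rest yB.
have c2A : {in B :\ y, forall v, c2 v \notin A}.
  by move=> v /c2C; rewrite in_setD => /andP[].
have ByS : B :\ y \subset S by apply: subset_trans BS; apply: subsetDl.
exists (paste (B :\ y) c2 c3); split; first split.
- move=> v vS; rewrite /paste; case: ifP => [/c2C|_]; last by apply c3P.
  by rewrite in_setD => /andP[].
- move=> u v uS vS euv; rewrite /paste.
  case: ifP => uB; case: ifP => vB.
  + exact: c2P.
  + have := c2A u uB; apply: contraNneq => ->.
    by move: vB; rewrite BE // => /negbFE.
  + have := c2A v vB; apply: contraNneq => <-.
    by move: uB; rewrite BE // => /negbFE.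
  + by apply c3P.
- move=> i iC; have [iA|iNA] := boolP (i \in A).
    by rewrite (class_paste_in BE) ?c3size.
  by rewrite (class_paste_out c2 ByS BE) // c2size // in_setD iNA.
Qed.

(** Exchange [z] and [y1]: [y1] enters [W], the other vertices outside the
    accessible classes are recoloured equitably, and [z] is added to one of the
    new classes.  Classes that reached [a] still do, since no path needs [W] and
    [W] keeps the vertex by which it could move.  In addition [y2], whose
    only neighbour in [W] was [z], can now move to [W], so its class has become
    accessible. *)
Lemma nearly_equitable_of_unmovable_solo y1 y2 : W != a ->
  {in A, forall X, X != W -> ~~ movable e c S z X} ->
  y1 \in B -> y2 \in B -> y1 != y2 -> ~~ e y1 y2 ->
  nbrs e (class c S W) y1 = [set z] -> nbrs e (class c S W) y2 = [set z] ->
  exists b' c', nearly_equitable e S C s a b' c' /\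
    A \proper accessible e S C a c'.
Proof.
move=> Wa z_unmovable y1B y2B y12 ey12 solo1 solo2.
have [y1S cy1NA] : y1 \in S /\ c y1 \notin A by apply/andP; rewrite -in_rest.
have [y2S cy2NA] : y2 \in S /\ c y2 \notin A by apply/andP; rewrite -in_rest.
have WC := subsetP AC W WA.
have zy1 : z != y1 by apply: contraNneq cy1NA => <-; rewrite cz.
have [c2 [[c2C c2P] c2size]] := equitable_rest y1B.
have c2A : {in B :\ y1, forall v, c2 v \notin A}.
  by move=> v /c2C; rewrite in_setD => /andP[].
have By1S : B :\ y1 \subset S by apply: subset_trans BS; apply: subsetDl.
have ez_y1 : e z y1.
  by have := set11 z; rewrite -solo1 !inE e_sym => /andP[].
(* z has a neighbour in each other accessible class, and y1 is one of its
   neighbours outside, so z lacks a neighbour in some class of c2 *)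
have zB : #|nbrs e (B :\ y1) z| < #|C :\: A|.
  have nm i : i \in A :\ W -> ~~ movable e c S z i.
    by rewrite in_setD1 => /andP[iW iA]; apply: z_unmovable.
  have := unmovable_degree (subsetDl A [set W]) nm.
  have := deg_lt zS; rewrite -(card_accessible e S C a c) -/A -/B (cardsD1 W A) WA.
  rewrite (cardsD1 y1 (nbrs e B z)) [y1 \in _]inE y1B ez_y1.
  suff -> : nbrs e B z :\ y1 = nbrs e (B :\ y1) z by card_lia.
  by apply/setP => v; rewrite !inE andbA.
have [j jCA jfree] : exists2 j, j \in C :\: A & movable e c2 (B :\ y1) z j.
  apply/exists_inP; apply: contraLR zB; rewrite negb_exists_in => /forall_inP nm.
  rewrite -leqNgt; apply: leq_trans (unmovable_degree (subxx (C :\: A)) nm).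
  exact: leq_addr.
have [jC jNA] : j \in C /\ j \notin A by move: jCA; rewrite in_setD => /andP[].
pose c1 := recolour c y1 W.
pose c3 := paste (B :\ y1) c2 c1.
pose c4 := recolour c3 z j.
have BE : {in S, forall v, (v \in B :\ y1) = (c1 v \notin A)}.
  move=> v vS; rewrite in_setD1 in_rest vS /c1 /recolour.
  by case: eqP => [_|_] /=; rewrite ?WA.
have zNB : z \in B :\ y1 = false.
  by rewrite in_setD1 in_rest cz WA !andbF.
have c3z : c3 z = W by rewrite /c3 /paste zNB /c1 /recolour (negbTE zy1).
have c3NB v : v \in S -> v \notin B :\ y1 -> c3 v \in A.
  by move=> vS vB; rewrite /c3 /paste (negbTE vB); move: vB; rewrite BE // negbK.
have c3B v : v \in B :\ y1 -> c3 v = c2 v by rewrite /c3 /paste => ->.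
have no_conflict u v : u \in S -> v \in S -> u != z -> v != z -> e u v ->
    v \notin B :\ y1 -> c3 u != c3 v.
  move=> uS vS uz vz euv vB; have [uB|uB] := boolP (u \in B :\ y1).
    rewrite c3B //; have := c2A u uB; apply: contraNneq => ->; exact: c3NB.
  have W_case w w' : w' \in S -> w' != z -> e w w' -> w = y1 -> c w' != W.
    move=> w'S w'z eww' wE; apply: contraNneq w'z => cw'.
    by rewrite -in_set1 -solo1 inE in_class w'S cw' eqxx -wE.
  rewrite /c3 /paste (negbTE uB) (negbTE vB) /c1 /recolour.
  case: (eqVneq u y1) (eqVneq v y1) => [uy|_] [vy|_].
  - by move: euv; rewrite uy vy e_irr.
  - by rewrite eq_sym; apply: W_case euv uy.
  - by apply: (W_case v u) => //; rewrite e_sym.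
  - by apply c_col.
have c4P : colouring e S C c4.
  have zj v : v \in S -> e z v -> c3 v != j.
    move=> vS ezv; have [vB|vB] := boolP (v \in B :\ y1); last first.
      by have := c3NB v vS vB; apply: contraTneq => ->.
    rewrite c3B //; apply: contraTneq ezv => c2v.
    by move/forall_inP: jfree; apply; rewrite in_class vB c2v eqxx.
  split=> [v vS|u v uS vS euv]; rewrite /c4 /recolour.
    case: eqP => // _; have [vB|vB] := boolP (v \in B :\ y1).
      by rewrite c3B //; move: (c2C v vB); rewrite in_setD => /andP[].
    exact/(subsetP AC)/c3NB.
  case: (eqVneq u z) (eqVneq v z) => [uz|uz] [vz|vz].
  - by move: euv; rewrite uz vz e_irr.
  - by rewrite eq_sym zj // -uz.
  - by rewrite zj // -vz e_sym.
  - have [vB|vB] := boolP (v \in B :\ y1); last exact: no_conflict.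
    have [uB|uB] := boolP (u \in B :\ y1); last first.
      by rewrite eq_sym no_conflict // e_sym.
    by rewrite !c3B // c2P.
have aA : a \in A by rewrite (accessibleP c_near) connect0.
exists j, c4; split.
  split=> //; [exact: (subsetP AC) | by apply: contraNneq jNA => <- |].
  move=> i iC; have := card_class_recolour c3 i j zS; rewrite c3z -/c4.
  have [iA|iNA] := boolP (i \in A); last first.
    rewrite (class_paste_out c2 By1S BE) // c2size ?in_setD ?iNA //.
    have -> : (i == W) = false by apply: contraNF iNA => /eqP ->.
    have -> : (i == a) = false by apply: contraNF iNA => /eqP ->.
    by rewrite !addn0.
  rewrite (class_paste_in BE) //.
  have := card_class_recolour c i W y1S; rewrite -/c1.
  have -> : (i == c y1) = false by apply: contraNF cy1NA => /eqP <-.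
  have -> : (i == j) = false by apply: contraNF jNA => /eqP <-.
  case: c_near => _ _ _ _ /(_ i iC).
  have -> : (i == b) = false by apply: contraNF b_inaccessible => /eqP <-.
  rewrite addn0; card_lia.
have class4 i : i \in A -> i != W -> class c4 S i = class c S i.
  move=> iA iW; apply/setP => v; rewrite !in_class.
  case: (boolP (v \in S)) => //= vS; rewrite /c4 /recolour.
  case: (eqVneq v z) => [->|_].
    by rewrite cz [W == i]eq_sym (negbTE iW); apply: contraNF jNA => /eqP ->.
  rewrite /c3 /paste; case: ifP => [vB|_].
    transitivity false; [|symmetry].
      by have := c2A v vB; apply: contraNF => /eqP ->.
    by move: vB; rewrite in_setD1 in_rest => /and3P[_ _]; apply: contraNF => /eqP ->.
  rewrite /c1 /recolour; case: (eqVneq v y1) => [->|//].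
  rewrite [W == i]eq_sym (negbTE iW); symmetry.
  by apply: contraNF cy1NA => /eqP ->.
pose H4 := moves e c4 S C.
have H4_of_H i k : i \in A -> k \in A -> i != W -> k != W -> H i k -> H4 i k.
  move=> iA kA iW kW /and4P[iC kC ik mv]; rewrite /H4 /moves iC kC ik.
  by rewrite /movable !class4.
have acc4 i : i \in A -> i != W -> connect H4 i a.
  move=> iA iW; have [p [pP _ pa]] := avoid_path (W_terminal iA iW) iW.
  elim: p i iA iW pP pa => [|k p IHp] i iA iW /=; first by move=> _ ->.
  case/andP=> Hik pP pa; rewrite !in_cons !negb_or => /and3P[_ Wk Wp].
  have kA : k \in A by apply: (path_accessible pP pa); rewrite mem_head.
  have kW : k != W by rewrite eq_sym.
  apply: connect_trans (connect1 _) (IHp k kA kW pP pa _).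
    exact: H4_of_H.
  by rewrite in_cons negb_or Wk.
have [X XA /andP[XW HWX]] : exists2 X, X \in A & (X != W) && H W X.
  have : connect H W a by rewrite -(accessibleP c_near).
  case/connectP=> p0 /shortenP[[|X p] pP Up _] aE.
    by case/eqP: Wa.
  case/andP: pP => HWX pP; exists X.
    by apply: (path_accessible pP (esym aE)); rewrite mem_head.
  by rewrite HWX andbT; apply: contraTneq Up => ->; rewrite /= mem_head.
have acc4W : connect H4 W a.
  apply: connect_trans (acc4 X XA XW); apply: connect1.
  have /and4P[_ XC WX /exists_inP[w wW wX]] := HWX.
  rewrite /H4 /moves WC XC WX; apply/exists_inP; exists w; last first.
    by rewrite /movable class4.
  have [wS /eqP cw] : w \in S /\ c w == W by apply/andP; rewrite -in_class.
  have wz : w != z by apply: contraTneq wX => ->; apply: z_unmovable.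
  rewrite in_class wS /c4 /recolour (negbTE wz) /c3 /paste in_setD1 in_rest.
  by rewrite cw WA !andbF /c1 /recolour cw if_same eqxx.
have y2B' : y2 \in B :\ y1 by rewrite in_setD1 eq_sym y12.
have y2z : y2 != z by apply: contraNneq cy2NA => ->; rewrite cz.
have c4y2 : c4 y2 = c2 y2 by rewrite /c4 /recolour (negbTE y2z) c3B.
have mvy2 : movable e c4 S y2 W.
  apply/forall_inP => v; rewrite in_class /c4 /recolour => /andP[vS].
  case: (eqVneq v z) => [_ /eqP jW|vz /eqP c3v]; first by rewrite jW WA in jNA.
  have vB : v \notin B :\ y1.
    by apply/negP => vB; have := c2A v vB; rewrite -c3B // c3v WA.
  move: c3v; rewrite /c3 /paste (negbTE vB) /c1 /recolour.
  case: eqP => [-> _|_ cv]; first by rewrite e_sym.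
  by apply: contraNN vz => e2v; rewrite -in_set1 -solo2 inE in_class vS cv eqxx.
have [lC lNA] : c2 y2 \in C /\ c2 y2 \notin A.
  by apply/andP; rewrite andbC -in_setD; apply: c2C.
apply/properP; split.
  apply/subsetP => i iA; rewrite inE (subsetP AC) //=.
  by case: (eqVneq i W) => [->|]; [apply: acc4W | apply: acc4].
exists (c2 y2) => //; rewrite inE lC; apply: connect_trans acc4W.
apply: connect1; rewrite /H4 /moves lC WC /=; apply/andP; split.
  by apply: contraNneq lNA => ->.
by apply/exists_inP; exists y2; rewrite // in_class y2S c4y2 eqxx.
Qed.
End Step.

(** Induction on the number of inaccessible classes. *)
Lemma equitable_of_nearly_equitable a b c :
  nearly_equitable e S C s a b c -> exists c', equitable e S C s c'.
Proof.
move: {2}#|_|.+1 (ltnSn #|C :\: accessible e S C a c|) => n.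
elim: n a b c => // n IHn a b c lt_n c_near.
pose A := accessible e S C a c; pose B := rest c S A; pose H := moves e c S C.
have c_col : colouring e S C c by case: c_near.
have [bA|bNA] := boolP (b \in A).
  move: bA; rewrite (accessibleP c_near) => /connectP[p0 /shortenP[p pP Up _] aE].
  have [c' [c'P _ _ _ c'size]] := shift_along_path e_sym e_irr c_col pP Up.
  exists c'; split=> // i iC; have := c'size i; rewrite -aE.
  by case: c_near => _ _ _ _ /(_ i iC); card_lia.
have [i iA ia] := exists_accessible e_sym c_near deg_lt bNA.
have accP := accessibleP c_near.
have [] := @terminal_block _ H a i; rewrite -?accP //.
move=> U [T []]; rewrite -accP => UA UT T0 Tprop.
have TA : T \subset A.
  by apply/subsetP => W /Tprop[]; rewrite -accP.
have aT : a \notin T by apply/negP => /Tprop[_]; rewrite eqxx.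
have T_term W : W \in T -> {in A, forall j, j != W -> connect (avoid H W) j a}.
  by case/Tprop=> _ _ term _ j; rewrite (accP j); apply: term.
have zclass y W z : nbrs e (class c S W) y = [set z] -> z \in class c S W.
  by move=> solo; have := set11 z; rewrite -solo inE => /andP[].
have Wa W : W \in T -> W != a by case/Tprop.
have WA W : W \in T -> W \in A by apply: subsetP.
pose good := [exists W in T, [exists y in B, [exists z, [exists X in A,
  [&& X != W, nbrs e (class c S W) y == [set z] & movable e c S z X]]]]].
have [|none] := boolP good.
  case/exists_inP=> W WT /exists_inP[y yB /existsP[z /exists_inP[X XA]]].
  case/and3P=> XW /eqP solo mv.
  exact: (equitable_of_movable_solo c_near bNA (WA W WT)
    (zclass _ _ _ solo) (T_term W WT) XA XW mv yB solo).
have unmv W y z X : W \in T -> y \in B -> nbrs e (class c S W) y = [set z] ->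
    X \in A -> X != W -> ~~ movable e c S z X.
  move=> WT yB solo XA XW; apply: contra none => mv.
  apply/exists_inP; exists W => //; apply/exists_inP; exists y => //.
  by apply/existsP; exists z; apply/exists_inP; exists X; rewrite // XW solo eqxx.
have T_closed : {in T, forall W, {in A, forall j, j != U -> j \notin T -> ~~ H W j}}.
  by move=> W /Tprop[_ _ _ clo] j; rewrite (accP j); apply: clo.
have [W [z [y1 [y2 [[WT y1B y2B y12] [ey12 solo1 solo2]]]]]] :=
  nonadjacent_solo_pair e_sym e_irr c_near deg_lt bNA UA UT T0 TA aT T_closed unmv.
have [b' [c' [c'_near Alt]]] := nearly_equitable_of_unmovable_solo c_near bNA
  (WA W WT) (zclass _ _ _ solo1) (T_term W WT) (Wa W WT)
  (fun X => @unmv W y1 z X WT y1B solo1) y1B y2B y12 ey12 solo1 solo2.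
apply: IHn c'_near.
have := card_accessible e S C a c; have := card_accessible e S C a c'.
by move: lt_n (proper_card Alt); rewrite -/A; card_lia.
Qed.

End Exchange.

(** Induction on the number of vertices plus edges.  After the deletion of an
    edge [x y], an equitable colouring either is proper for the original graph
    or gives [x] and [y] the same colour; then moving [x] to a class without
    neighbours of [x] yields a nearly equitable colouring. *)
Theorem hajnal_szemeredi (V I : finType) (e : rel V) (i0 : I) (s : nat)
    (S : {set V}) (C : {set I}) :
  symmetric e -> irreflexive e -> #|S| = #|C| * s ->
  {in S, forall x, #|nbrs e S x| < #|C|} ->
  exists c : V -> I, equitable e S C s c.
Proof.
move: {2}_.+1 (ltnSn (#|S| + #|[set p | [&& p.1 \in S, p.2 \in S & e p.1 p.2]]|)) => n.
elim: n e S C => // n IHn e S C lt_n e_sym e_irr cardS deg_lt.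
pose E (e : rel V) (S : {set V}) := [set p | [&& p.1 \in S, p.2 \in S & e p.1 p.2]].
have [S0|[x0 x0S]] := set_0Vmem S.
  exists (fun=> i0); split; first by split=> v; rewrite S0 inE.
  move=> i iC; move: cardS; rewrite S0 cards0 (cardD1 i) iC mulSn => cE.
  have -> : s = 0 by lia.
  by apply: eq_card0 => v; rewrite in_class inE.
have [/existsP[[x y]] | noE] := boolP [exists p, p \in E e S]; last first.
  have [i iC] : exists i, i \in C.
    by apply/set0Pn; rewrite -card_gt0; apply: leq_ltn_trans (deg_lt x0 x0S).
  have cardSC : #|S| = s + #|C :\ i| * s by rewrite cardS (cardsD1 i C) iC mulSn.
  have s_gt0 : 0 < s.
    have : 0 < #|S| by rewrite card_gt0; apply/set0Pn; exists x0.
    by rewrite cardS muln_gt0 => /andP[].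
  pose S1 := [set x in take s (enum S)].
  have S1S : S1 \subset S.
    by apply/subsetP => x; rewrite inE => /mem_take; rewrite mem_enum.
  have cardS1 : #|S1| = s.
    rewrite cardsE (card_uniqP _) ?take_uniq ?enum_uniq // size_takel //.
    by rewrite -cardE; lia.
  have noe x y : x \in S -> y \in S -> ~~ e x y.
    move=> xS yS; apply: contra noE => exy; apply/existsP; exists (x, y).
    by rewrite inE xS yS.
  have cardS2 : #|S :\: S1| = #|C :\ i| * s.
    by have := cardsID S1 S; rewrite (setIidPr S1S) cardS1 cardSC => /addnI.
  have [] := IHn e (S :\: S1) (C :\ i) _ e_sym e_irr cardS2.
  - rewrite -ltnS; apply: leq_trans _ lt_n; rewrite ltnS -addSn leq_add //.
      by rewrite cardS2 cardSC; lia.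
    apply/subset_leq_card/subsetP => p; rewrite !inE.
    by case/and3P=> /andP[_ ->] /andP[_ ->] ->.
  - move=> x xS2; have -> : #|nbrs e (S :\: S1) x| = 0.
      apply: eq_card0 => v; rewrite !inE; apply/negP => /andP[/andP[_ vS]].
      by apply/negP; apply: noe => //; move: xS2; rewrite inE => /andP[].
    rewrite -(ltn_pmul2r s_gt0) mul0n -cardS2 card_gt0.
    by apply/set0Pn; exists x.
  - move=> c [[cC _] csize]; exists (fun v => if v \in S1 then i else c v).
    split; first split.
    + move=> v vS; case: ifP => // vS1; have : v \in S :\: S1 by rewrite inE vS1.
      by move/cC; rewrite inE => /andP[].
    + by move=> u v uS vS euv; have := noe u v uS vS; rewrite euv.
    + move=> k kC; case: (eqVneq k i) => [->|ki].
        rewrite -cardS1; apply: eq_card => v; rewrite in_class.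
        have [vS1|vS1] := boolP (v \in S1); first by rewrite eqxx (subsetP S1S).
        apply/negP => /andP[vS /eqP cv].
        have /cC : v \in S :\: S1 by rewrite inE vS1.
        by rewrite cv !inE eqxx.
      rewrite -(csize k) ?inE ?ki //; apply: eq_card => v; rewrite !in_class in_setD.
      by case: (v \in S1); rewrite //= [i == k]eq_sym (negbTE ki) andbF.
rewrite inE /= => /and3P[xS yS exy].
pose e' := [rel u v | e u v && ([set u; v] != [set x; y])].
have e'_sym : symmetric e' by move=> u v; rewrite /= e_sym setUC.
have e'_irr : irreflexive e' by move=> u; rewrite /= e_irr.
have [] := IHn e' S C _ e'_sym e'_irr cardS.
- rewrite -ltnS; apply: leq_trans _ lt_n; rewrite ltnS -addnS leq_add2l; apply: proper_card.
  apply/properP; split.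
    by apply/subsetP => p; rewrite !inE => /and3P[-> ->] /andP[->].
  by exists (x, y); rewrite !inE /= xS yS ?exy // eqxx andbF.
- move=> v vS; apply: leq_ltn_trans (deg_lt v vS); apply/subset_leq_card/subsetP.
  by move=> u; rewrite !inE => /andP[->] /andP[->].
move=> c [[cC cP] csize].
have [cxy|cxy] := eqVneq (c x) (c y); last first.
  exists c; split=> //; split=> // u v uS vS euv.
  have [/eqP uvE|uvN] := boolP ([set u; v] == [set x; y]); last first.
    by apply: cP => //; rewrite /= euv uvN.
  have uv : u != v by apply: contraTneq euv => ->; rewrite e_irr.
  have := set21 x y; have := set22 x y; rewrite -uvE !inE.
  case/orP=> /eqP yE; case/orP=> /eqP xE; move: cxy; rewrite ?xE ?yE ?eqxx //.
  by rewrite eq_sym.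
have xC : c x \in C by apply: cC.
have [j jC jfree] : exists2 j, j \in C :\ c x & movable e c S x j.
  apply/exists_inP; apply: contraLR (deg_lt x xS).
  rewrite negb_exists_in => /forall_inP nm; rewrite -leqNgt.
  rewrite (card_nbrs_split e c S C) (bigD1 (c x)) //=.
  rewrite (cardsD1 (c x) C) xC -addnA leq_add //.
    rewrite card_gt0; apply/set0Pn; exists y.
    by rewrite inE in_class yS cxy eqxx.
  apply: leq_trans (leq_addr _ _); rewrite -sum1_card.
  rewrite (eq_bigl (fun i => (i \in C) && (i != c x))); last first.
    by move=> i; rewrite !inE andbC.
  apply: leq_sum => i /andP[iC ix]; apply: unmovable_nbrs_gt0; apply: nm.
  by rewrite !inE ix.
have [jx jC'] : j != c x /\ j \in C by apply/andP; rewrite -in_setD1.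
have same_edge u v : e u v -> e' u v = false -> u = x /\ v = y \/ u = y /\ v = x.
  move=> euv; rewrite /= euv => /negbFE/eqP uvE.
  have uv : u != v by apply: contraTneq euv => ->; rewrite e_irr.
  have := set21 u v; have := set22 u v; rewrite uvE !inE.
  case/orP=> /eqP vE; case/orP=> /eqP uE; move: uv; rewrite ?uE ?vE ?eqxx //.
    by right.
  by left.
have mvP v : v \in S -> c v = j -> ~~ e x v.
  by move=> vS cv; move/forall_inP: jfree; apply; rewrite in_class vS cv eqxx.
have r_col : colouring e S C (recolour c x j).
  split=> [v vS|u v uS vS euv]; rewrite /recolour; first by case: eqP => // _; apply: cC.
  case: (eqVneq u x) (eqVneq v x) => [ux|ux] [vx|vx].
  - by move: euv; rewrite ux vx e_irr.
  - by apply: contraTneq euv => jv; rewrite ux; apply: mvP.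
  - by apply: contraTneq euv => jv; rewrite vx e_sym mvP.
  - apply: cP => //; apply/negPn/negP => /negbTE /same_edge[] // [uE vE].
      by rewrite uE eqxx in ux.
    by rewrite vE eqxx in vx.
have r_near : nearly_equitable e S C s (c x) j (recolour c x j).
  split=> //; first by rewrite eq_sym.
  by move=> i iC; rewrite card_class_recolour // csize.
apply: equitable_of_nearly_equitable r_near => //.
move=> S' C' ltS cardS' deg'; apply: IHn => //.
rewrite -ltnS; apply: leq_trans _ lt_n; rewrite ltnS -addSn leq_add ?proper_card //.
apply/subset_leq_card/subsetP => p; rewrite !inE.
by case/and3P=> /(subsetP (proper_sub ltS)) -> /(subsetP (proper_sub ltS)) ->.
Qed.

(** * Clique tilings and their weights *)

Local Open Scope ring_scope.

Section CliqueTilings.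
Variables (G : sgraph) (r : nat).
Implicit Types (K A X Z W : {set G}) (T : {set {set G}}).

Lemma edgesP A :
  reflect (exists x y : G, adj x y /\ A = [set x; y]) (A \in edges G).
Proof.
apply: (iffP imset2P) => [[x y _]|[x [y [xy ->]]]].
  by rewrite inE => /andP[_ xy] ->; exists x, y.
by exists x y; rewrite ?inE.
Qed.

Lemma edge_mem (x y : G) : adj x y -> [set x; y] \in edges G.
Proof. by move=> xy; apply/edgesP; exists x, y. Qed.

Lemma adj_neq (x y : G) : adj x y -> x != y.
Proof. by apply: contraTneq => ->; rewrite adj_irr. Qed.

Lemma cliqueP K : reflect {in K &, forall x y, x != y -> adj x y} (clique K).
Proof.
apply: (iffP forall_inP) => [cK x y xK yK xy|cK x xK].
  by move/forall_inP: (cK x xK) => /(_ y yK); rewrite xy.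
by apply/forall_inP => y yK; apply/implyP; apply: cK.
Qed.

Lemma cliqueS K K' : K' \subset K -> clique K -> clique K'.
Proof.
move=> /subsetP sub /cliqueP cK; apply/cliqueP => x y xK yK.
by apply: cK; apply: sub.
Qed.

Lemma clique0 : clique (set0 : {set G}).
Proof. by apply/cliqueP => x; rewrite inE. Qed.

Lemma cliqueU1 x K : {in K, forall y, adj x y} -> clique K -> clique (x |: K).
Proof.
move=> xK /cliqueP cK; apply/cliqueP => u v; rewrite !in_setU1.
case/orP=> [/eqP ->|uK]; case/orP=> [/eqP ->|vK] uv.
- by rewrite eqxx in uv.
- exact: xK.
- by rewrite adj_sym; apply: xK.
- exact: cK.
Qed.

Definition clique_tiling T X :=
  partition T X /\ {in T, forall K, #|K| = r /\ clique K}.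

Lemma clique_tiling0 : clique_tiling set0 set0.
Proof. by split=> [|K]; rewrite ?inE // partition_set0. Qed.

Lemma clique_tiling1 K : (0 < r)%N -> #|K| = r -> clique K -> clique_tiling [set K] K.
Proof.
move=> r_gt0 cardK cK; split=> [|_ /set1P ->] //.
rewrite /partition /cover big_set1 eqxx trivIset1 inE.
by rewrite eq_sym -card_gt0 cardK.
Qed.

Section Weights.
Variable f : {set G} -> int.

Definition weight K := \sum_(A in edges G | A \subset K) f A.
Definition link (x : G) K := \sum_(a in K) f [set x; a].
Definition tiling_weight T := \sum_(K in T) weight K.

Lemma clique_tilingU T T' X X' : [disjoint X & X'] ->
  clique_tiling T X -> clique_tiling T' X' ->
  clique_tiling (T :|: T') (X :|: X') /\
  tiling_weight (T :|: T') = tiling_weight T + tiling_weight T'.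
Proof.
move=> dXX' [pT cT] [pT' cT'].
have dTT' : [disjoint T & T'].
  apply/pred0P => K /=; apply/negP => /andP[KT KT'].
  have := partition_neq0 pT KT; case/set0Pn => v vK.
  have vX := subsetP (partitionS pT KT) v vK.
  have vX' := subsetP (partitionS pT' KT') v vK.
  by move/pred0P: dXX' => /(_ v); rewrite /= vX vX'.
split; last first.
  rewrite /tiling_weight -bigU //=; apply: eq_bigl => K.
  by rewrite [LHS]inE [RHS]inE.
split; last by move=> K /setUP[/cT|/cT'].
case/and3P: pT => /eqP cX tT nT; case/and3P: pT' => /eqP cX' tT' nT'.
apply/and3P; split.
- by rewrite /cover bigcup_setU -!/(cover _) cX cX'.
- by apply: trivIsetU => //; rewrite cX cX'.
- by rewrite inE negb_or nT.
Qed.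

Lemma sum_tiling_edges T X : partition T X ->
  \sum_(A in tiling_edges T) f A = tiling_weight T.
Proof.
move=> pT; rewrite /tiling_weight /weight.
rewrite (exchange_big_dep (mem (edges G))) /=; last by move=> K A _ /andP[].
rewrite (eq_bigl (fun A => (A \in edges G) && [exists K in T, A \subset K])); last first.
  by move=> A; rewrite inE.
rewrite big_mkcondr /=; apply: eq_bigr => A AE; case: exists_inP => [[K KT AK]|noK].
  rewrite (big_pred1 K) // => K'; rewrite AE /=; apply/andP/eqP => [[K'T AK']|->//].
  have [x [y [_ AE']]] := edgesP _ AE.
  have xA : x \in A by rewrite AE' set21.
  apply: contraTeq (partition_trivIset pT) => KK'.
  apply/negP => /trivIsetP /(_ K' K K'T KT KK') /pred0P/(_ x).
  by rewrite /= (subsetP AK') // (subsetP AK).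
rewrite big_pred0 // => K; apply/negP => /and3P[KT _ AK].
by apply: noK; exists K.
Qed.

Lemma weight_setU1 x K : x \notin K -> {in K, forall a, adj x a} ->
  weight (x |: K) = weight K + link x K.
Proof.
move=> xNK xK; rewrite /weight (bigID (fun A => x \in A)) /= addrC; congr (_ + _).
  apply: eq_bigl => A; rewrite -andbA; congr (_ && _).
  apply/andP/idP => [[/subsetP AK xA]|/subsetP AK].
    apply/subsetP => v vA; have := AK v vA; rewrite in_setU1.
    by case/orP => // /eqP vx; move: xA; rewrite -vx vA.
  split; first by apply/subsetP => v /AK; apply: setU1r.
  by apply: contra xNK => /AK.
have edge_inj : {in K &, injective (fun a => [set x; a])}.
  move=> a a' aK a'K /= E; have : a' \in [set x; a] by rewrite E set22.
  rewrite !inE => /orP[/eqP a'x|/eqP->//].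
  by move: xNK; rewrite -a'x a'K.
rewrite /link -(big_imset (fun A => f A) edge_inj) /=; apply: eq_bigl => A.
apply/andP/imsetP => [[/andP[/edgesP[u [v [uv ->]]] sub] xuv]|[a aK ->]]; last first.
  rewrite edge_mem ?xK // set21; split=> //=.
  by apply/subsetP => v; rewrite !inE => /orP[/eqP->|/eqP->]; rewrite ?eqxx // aK orbT.
have inK w : w != x -> w \in [set u; v] -> w \in K.
  by move=> wx /(subsetP sub); rewrite in_setU1 (negbTE wx).
move: xuv; rewrite !inE => /orP[/eqP xu|/eqP xv].
  exists v; last by rewrite xu.
  by apply: inK; rewrite ?set22 // xu eq_sym adj_neq.
exists u; last by rewrite xv setUC.
by apply: inK; rewrite ?set21 // xv adj_neq.
Qed.

Lemma abs_weight_le K : edge_labelling f -> `|weight K| <= (2 ^ #|K|)%:Z.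
Proof.
move=> f_lab; apply: (le_trans (ler_norm_sum _ _ _)).
apply: (@le_trans _ _ (\sum_(A in powerset K) 1)); last first.
  by rewrite sumr_const card_powerset -mulr_natr mul1r natz.
rewrite big_mkcond [X in _ <= X]big_mkcond; apply: ler_sum => A _.
rewrite powersetE; case: ifP => [/andP[AE ->]|_]; last by case: ifP.
by case: (f_lab A AE) => ->; rewrite ?normrN normr1.
Qed.

Lemma card_clique_tiling T X : clique_tiling T X -> #|X| = (#|T| * r)%N.
Proof. by case=> pT cT; apply: (card_uniform_partition _ pT) => K /cT[]. Qed.

Lemma abs_tiling_weight_le T X : edge_labelling f -> clique_tiling T X ->
  `|tiling_weight T| <= (2 ^ r * #|T|)%:Z.
Proof.
move=> f_lab [_ cT]; apply: (le_trans (ler_norm_sum _ _ _)).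
apply: (@le_trans _ _ (\sum_(K in T) (2 ^ r)%:Z)); last first.
  by rewrite sumr_const -mulr_natr natz PoszM.
apply: ler_sum => K /cT[<- _]; exact: abs_weight_le.
Qed.

End Weights.
End CliqueTilings.

(** Apply [hajnal_szemeredi] to the complement graph: its independent sets are
    cliques, and its degrees are less than [D]. *)
Lemma exists_clique_tiling (G : sgraph) (r D : nat) (X : {set G}) :
  (forall x : G, #|G| <= D + degree x)%N -> (0 < r)%N -> (r %| #|X|)%N ->
  (r * D <= #|X|)%N -> exists T, clique_tiling r T X.
Proof.
move=> degD r_gt0 /dvdnP[k cardX] le_rD.
have [X0|[x0 x0X]] := set_0Vmem X.
  by exists set0; rewrite X0; apply: clique_tiling0.
have k_gt0 : (0 < k)%N.
  have : (0 < #|X|)%N by rewrite card_gt0; apply/set0Pn; exists x0.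
  by rewrite cardX muln_gt0 => /andP[].
pose e := [rel x y : G | (x != y) && ~~ adj x y].
have e_sym : symmetric e by move=> x y; rewrite /= eq_sym adj_sym.
have e_irr : irreflexive e by move=> x; rewrite /= eqxx.
have [||c [[_ cP] csize]] := hajnal_szemeredi (Ordinal k_gt0) (s := r) (S := X)
  (C := setT) e_sym e_irr.
- by rewrite cardX cardsT card_ord.
- move=> x xX; rewrite cardsT card_ord.
  have Dk : (D <= k)%N by rewrite -(leq_pmul2l r_gt0) (mulnC r k) -cardX.
  apply: leq_trans Dk; have := degD x.
  have -> : #|G| = (degree x + #|[set y | e x y]| + 1)%N.
    rewrite -cardsT (cardsD1 x) inE -(cardsID [set y | adj x y]).
    rewrite addnC; congr (_ + _ + _)%N; apply: eq_card => y; rewrite !inE andbT.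
      by apply: andb_idl => /adj_neq; rewrite eq_sym.
    by rewrite andbC eq_sym.
  have : (#|nbrs e X x| <= #|[set y | e x y]|)%N.
    by apply/subset_leq_card/subsetP => y; rewrite !inE => /andP[].
  lia.
exists (preim_partition c X); split; first exact: preim_partitionP.
move=> K /imsetP[x xX ->].
have KE : [set y in X | c x == c y] = class c X (c x).
  by apply/setP => y; rewrite !inE eq_sym.
rewrite KE csize ?inE //; split=> //; apply/cliqueP => u v; rewrite !inE.
case/andP=> uX /eqP cu /andP[vX /eqP cv] uv.
have := cP u v uX vX; rewrite /= uv cu cv eqxx /=.
by case: (adj u v) => // /(_ isT).
Qed.

(** * Gadgets *)

Section Gadgets.
Variables (G : sgraph) (r : nat) (f : {set G} -> int).
Hypothesis r_gt0 : (0 < r)%N.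
Implicit Types (x y : G) (A B X Z : {set G}) (T : {set {set G}}).

Definition common x y := [set v : G | adj x v && adj y v].

Lemma commonC x y : common x y = common y x.
Proof. by apply/setP => v; rewrite !inE andbC. Qed.

(** Only strict inequality in one direction is recorded: exchanging [x] and [y]
    reverses it. *)
Definition gadget Z (t : G * G * {set G} * {set G}) :=
  let: (x, y, A, B) := t in
  [&& [&& x \notin Z, y \notin Z & x != y],
      [&& clique A, #|A| == r.-1 & A \subset common x y :\: Z],
      [&& clique B, #|B| == r.-1 & B \subset common x y :\: Z],
      [disjoint A & B] &
      link f y A + link f x B < link f x A + link f y B].

Lemma clique_tiling_pair x y A B : x != y ->
  clique A -> #|A| = r.-1 -> A \subset common x y ->
  clique B -> #|B| = r.-1 -> B \subset common x y -> [disjoint A & B] ->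
  clique_tiling r [set x |: A; y |: B] ((x |: A) :|: (y |: B)) /\
  tiling_weight f [set x |: A; y |: B] =
    weight f A + weight f B + (link f x A + link f y B).
Proof.
move=> xy cA cardA Axy cB cardB Bxy dAB.
have xA v : v \in A -> adj x v by move/(subsetP Axy); rewrite inE => /andP[].
have yA v : v \in A -> adj y v by move/(subsetP Axy); rewrite inE => /andP[].
have xB v : v \in B -> adj x v by move/(subsetP Bxy); rewrite inE => /andP[].
have yB v : v \in B -> adj y v by move/(subsetP Bxy); rewrite inE => /andP[].
have xNA : x \notin A by apply/negP => /xA; rewrite adj_irr.
have xNB : x \notin B by apply/negP => /xB; rewrite adj_irr.
have yNA : y \notin A by apply/negP => /yA; rewrite adj_irr.
have yNB : y \notin B by apply/negP => /yB; rewrite adj_irr.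
have dXY : [disjoint x |: A & y |: B].
  apply/pred0P => v /=; rewrite !in_setU1; apply/negP => /andP[].
  case/orP=> [/eqP ->|vA]; case/orP => [/eqP vy|vB].
  - by rewrite vy eqxx in xy.
  - by rewrite vB in xNB.
  - by rewrite -vy vA in yNA.
  - by move/pred0P: dAB => /(_ v); rewrite /= vA vB.
have tA : clique_tiling r [set x |: A] (x |: A).
  apply: clique_tiling1 => //; last exact: cliqueU1.
  by rewrite cardsU1 xNA cardA add1n prednK.
have tB : clique_tiling r [set y |: B] (y |: B).
  apply: clique_tiling1 => //; last exact: cliqueU1.
  by rewrite cardsU1 yNB cardB add1n prednK.
have [tAB wAB] := clique_tilingU f dXY tA tB.
split=> //; rewrite wAB /tiling_weight !big_set1 !weight_setU1 //.
ring.
Qed.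

Lemma gadget_tilings Z x y A B : gadget Z (x, y, A, B) ->
  exists X T1 T2, [/\ [disjoint Z & X], #|X| = (2 * r)%N,
    clique_tiling r T1 X, clique_tiling r T2 X &
    tiling_weight f T2 + 1 <= tiling_weight f T1].
Proof.
case/and5P=> /and3P[xZ yZ xy] /and3P[cA /eqP cardA].
rewrite subsetD => /andP[Axy AZ] /and3P[cB /eqP cardB].
rewrite subsetD => /andP[Bxy BZ] dAB lt.
have yx : y != x by rewrite eq_sym.
have Ayx := Axy; rewrite commonC in Ayx; have Byx := Bxy; rewrite commonC in Byx.
have [t1 w1] := clique_tiling_pair xy cA cardA Axy cB cardB Bxy dAB.
have [t2 w2] := clique_tiling_pair yx cA cardA Ayx cB cardB Byx dAB.
have E : (y |: A) :|: (x |: B) = (x |: A) :|: (y |: B).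
  by rewrite setUACA [[set y] :|: [set x]]setUC -setUACA.
rewrite E in t2.
exists ((x |: A) :|: (y |: B)), [set x |: A; y |: B], [set y |: A; x |: B].
split=> //; last by rewrite w1 w2 -addrA lerD2l lezD1.
  apply/pred0P => v /=; apply/negP => /andP[vZ]; rewrite !inE.
  case/orP=> /orP[/eqP vE|vE].
  - by rewrite -vE vZ in xZ.
  - by move/pred0P: AZ => /(_ v); rewrite /= vE vZ.
  - by rewrite -vE vZ in yZ.
  - by move/pred0P: BZ => /(_ v); rewrite /= vE vZ.
rewrite (card_clique_tiling t1); congr (_ * _)%N; rewrite cards2.
suff -> : x |: A != y |: B by [].
apply/eqP => E'; have := setU11 x A; rewrite E' in_setU1 (negbTE xy) /=.
by move/(subsetP Bxy); rewrite inE adj_irr.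
Qed.

(** Greedy selection.  [T1] collects the heavier and [T2] the lighter tiling of
    each gadget found so far. *)
Lemma disjoint_gadgets m : exists j Z T1 T2,
  [/\ (j <= m)%N, #|Z| = (2 * r * j)%N, clique_tiling r T1 Z,
      clique_tiling r T2 Z & tiling_weight f T2 + j%:Z <= tiling_weight f T1] /\
  (j = m \/ forall t, ~~ gadget Z t).
Proof.
elim: m => [|m [j [Z [T1 [T2 [[le_jm cardZ t1 t2 w] alt]]]]]].
  exists 0%N, set0, set0, set0; split; last by left.
  split; rewrite ?cards0 ?muln0 //; try exact: clique_tiling0.
  by rewrite addr0.
have [t tP|none] := pickP (gadget Z); last first.
  exists j, Z, T1, T2; split; first by split=> //; apply: leqW.
  by right => t; rewrite none.
case: alt => [jm|/(_ t)]; last by rewrite tP.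
case: t tP => [[[x y] A] B] /gadget_tilings[X [T1' [T2' [dZX cardX t1' t2' w']]]].
have [u1 wu1] := clique_tilingU f dZX t1 t1'.
have [u2 wu2] := clique_tilingU f dZX t2 t2'.
exists j.+1, (Z :|: X), (T1 :|: T1'), (T2 :|: T2'); split; last by left; rewrite jm.
split=> //.
- by rewrite cardsU (disjoint_setI0 dZX) cards0 subn0 cardZ cardX; ring.
- by have := lerD w w'; rewrite addrACA -PoszD addn1 wu1 wu2.
Qed.

Variable D : nat.
Hypothesis degD : forall x, (#|G| <= D + degree x)%N.

Lemma exists_common_nbr (Y W : {set G}) :
  (#|Y| * D + #|W| < #|G|)%N -> exists2 c : G, c \notin W & {in Y, forall y, adj y c}.
Proof.
move=> small; pose nonadj y := [set v | ~~ adj y v].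
have card_nonadj y : (#|nonadj y| <= D)%N.
  have := degD y; have := cardsC [set v | adj y v].
  have -> : ~: [set v | adj y v] = nonadj y by apply/setP => v; rewrite !inE.
  by rewrite /degree; lia.
have le : (#|\bigcup_(y in Y) nonadj y| <= #|Y| * D)%N.
  rewrite -sum_nat_const; elim/big_ind2: _ => [|A m B n Am Bn|y yY].
  - by rewrite cards0.
  - by apply: leq_trans (leq_add Am Bn); rewrite cardsU leq_subr.
  - exact: card_nonadj.
pose bad := (\bigcup_(y in Y) nonadj y) :|: W.
have : (0 < #|~: bad|)%N.
  have := cardsC bad; have : (#|bad| <= #|\bigcup_(y in Y) nonadj y| + #|W|)%N.
    by rewrite cardsU leq_subr.
  by lia.
rewrite card_gt0 => /set0Pn[c]; rewrite inE in_setU negb_or => /andP[cY cW].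
exists c => // y yY; apply: contraNT cY => yc; apply/bigcupP; exists y => //.
by rewrite inE.
Qed.

(** * Labellings without gadgets *)

Section Rigid.
Variable Z : {set G}.
Hypothesis no_gadget : forall t, ~~ gadget Z t.
Hypothesis r_ge3 : (3 <= r)%N.
Hypothesis room : (#|Z| + r + r.+1 * D < #|G|)%N.

Lemma common_nbr_list (s : seq G) : (size s <= r.+1)%N ->
  exists2 c : G, c \notin Z & {in s, forall y, adj y c}.
Proof.
move=> le_s; have [|c cZ cs] := @exists_common_nbr [set y in s] Z.
  apply: leq_ltn_trans room; rewrite addnC -addnA leq_add2l.
  apply: leq_trans (leq_addl _ _); rewrite leq_mul2r cardsE.
  by rewrite (leq_trans (card_size s)) ?orbT.
by exists c => // y ys; apply: cs; rewrite inE.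
Qed.

Lemma extend_clique x y (W Q : {set G}) k : (#|W| + r.+1 * D < #|G|)%N ->
  clique Q -> Q \subset common x y -> (#|Q| <= k <= r)%N ->
  exists Q' : {set G}, [/\ Q \subset Q', clique Q', #|Q'| = k,
    Q' \subset common x y & Q' :\: Q \subset ~: W].
Proof.
move=> roomW cQ Qxy; elim: k => [|k IHk]; case/andP.
  rewrite leqn0 => /eqP Q0 _; exists Q; split=> //.
  by rewrite setDv sub0set.
rewrite leq_eqVlt => /orP[/eqP Qk _|lt_Qk lt_kr].
  by exists Q; split=> //; rewrite setDv sub0set.
have [|Q' [QQ' cQ' cardQ' Q'xy Q'W]] := IHk.
  by rewrite -ltnS lt_Qk ltnW.
have [|c cW cY] := @exists_common_nbr (x |: (y |: Q')) W.
  apply: leq_ltn_trans roomW; rewrite addnC leq_add2l leq_mul2r.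
  apply/orP; right; rewrite -cardQ' in lt_kr.
  by rewrite !cardsU1; case: (_ \in _); case: (_ \in _); rewrite /=; lia.
have xc : adj x c by apply: cY; rewrite setU11.
have yc : adj y c by apply: cY; rewrite in_setU1 setU11 orbT.
have Q'c v : v \in Q' -> adj c v.
  by move=> vQ; rewrite adj_sym; apply: cY; rewrite !in_setU1 vQ !orbT.
have cNQ' : c \notin Q' by apply/negP => /Q'c; rewrite adj_irr.
exists (c |: Q'); split.
- by apply: subset_trans QQ' (subsetUr _ _).
- exact: cliqueU1.
- by rewrite cardsU1 cNQ' cardQ'.
- by rewrite subUset sub1set inE xc yc.
- apply/subsetP => v; rewrite in_setD in_setU1 => /andP[vQ /orP[/eqP ->|vQ']].
    by rewrite inE.
  by apply: (subsetP Q'W); rewrite inE vQ.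
Qed.

Lemma label_sym x y : f [set x; y] = f [set y; x].
Proof. by rewrite setUC. Qed.

Lemma link_eq x y A B : x \notin Z -> y \notin Z -> x != y ->
  clique A -> #|A| = r.-1 -> A \subset common x y :\: Z ->
  clique B -> #|B| = r.-1 -> B \subset common x y :\: Z -> [disjoint A & B] ->
  link f x A - link f y A = link f x B - link f y B.
Proof.
move=> xZ yZ xy cA cardA Axy cB cardB Bxy dAB.
have := no_gadget (x, y, A, B); have := no_gadget (x, y, B, A).
rewrite /= xZ yZ xy cA cB cardA cardB !eqxx Axy Bxy dAB disjoint_sym dAB /=.
rewrite -!leNgt.
move: (link f x A) (link f y A) (link f x B) (link f y B); clear; lia.
Qed.

(** Take an [r]-clique [C] containing [c] and [c'], and a further clique [B]
    disjoint from it.  By [link_eq] all sets [C :\ v] have the same difference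
    as [B], so [f [set x; v] - f [set y; v]] does not depend on [v] in [C]. *)
Lemma balanced_adj x y c c' : x \notin Z -> y \notin Z -> x != y ->
  c \in common x y :\: Z -> c' \in common x y :\: Z -> adj c c' ->
  f [set x; c] - f [set y; c] = f [set x; c'] - f [set y; c'].
Proof.
move=> xZ yZ xy cxy c'xy cc'.
have cNc' : c != c' := adj_neq cc'.
have clique2 : clique [set c; c'].
  apply: cliqueU1; first by move=> v /set1P ->.
  by apply/cliqueP => u v /set1P -> /set1P ->; rewrite eqxx.
have roomZ : (#|Z| + r.+1 * D < #|G|)%N.
  by apply: leq_ltn_trans room; rewrite leq_add2r leq_addr.
have sub2 : [set c; c'] \subset common x y :\: Z by rewrite subUset !sub1set cxy.
have [||C [cC cliC cardC Cxy CZ]] :=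
    @extend_clique x y Z [set c; c'] r roomZ clique2.
- by apply: subset_trans sub2 (subsetDl _ _).
- by rewrite cards2 cNc' leqnn (ltnW r_ge3).
have {CZ Cxy}Cxy : C \subset common x y :\: Z.
  apply/subsetP => v vC; have [/(subsetP sub2)//|vNcc] := boolP (v \in [set c; c']).
  have : v \in ~: Z by apply: (subsetP CZ); rewrite in_setD vNcc.
  by rewrite in_setD inE => ->; apply: (subsetP Cxy).
have [|||B [_ cliB cardB Bxy BW]] :=
    @extend_clique x y (Z :|: C) set0 r.-1 _ (clique0 G).
- apply: leq_ltn_trans room; rewrite leq_add2r -[in X in (_ <= _ + X)%N]cardC.
  by rewrite cardsU leq_subr.
- exact: sub0set.
- by rewrite cards0 leq_pred.
rewrite setD0 setCU subsetI in BW; case/andP: BW => BZ BC.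
have {BZ Bxy}Bxy : B \subset common x y :\: Z by rewrite setDE subsetI Bxy.
have cCm : c \in C by apply: (subsetP cC); rewrite set21.
have c'Cm : c' \in C by apply: (subsetP cC); rewrite set22.
have drop v : v \in C ->
    link f x (C :\ v) - link f y (C :\ v) = link f x B - link f y B.
  move=> vC; apply: link_eq => //.
  - exact: cliqueS (subsetDl _ _) cliC.
  - by have := cardsD1 v C; rewrite vC cardC => ->.
  - exact: subset_trans (subsetDl _ _) Cxy.
  - rewrite disjoint_sym disjoints_subset; apply: subset_trans BC _.
    by rewrite setCS subsetDl.
have total v : v \in C -> f [set x; v] - f [set y; v] =
    link f x C - link f y C - (link f x B - link f y B).
  move=> vC; rewrite -(drop v vC) /link !(big_setD1 v vC) /=; ring.
by rewrite !total.
Qed.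

(** Reduce to [balanced_adj] through a common neighbour of all four vertices. *)
Lemma balanced x y c c' : x \notin Z -> y \notin Z -> x != y ->
  c \in common x y :\: Z -> c' \in common x y :\: Z ->
  f [set x; c] - f [set y; c] = f [set x; c'] - f [set y; c'].
Proof.
move=> xZ yZ xy cxy c'xy.
have [|d dZ dP] := @common_nbr_list [:: x; y; c; c']; first exact: r_ge3.
have dxy : d \in common x y :\: Z.
  by rewrite !inE dZ !dP // !inE eqxx ?orbT.
by rewrite (@balanced_adj x y c d) ?(@balanced_adj x y c' d) // dP // !inE eqxx ?orbT.
Qed.

Definition triangle u a b :=
  [&& u \notin Z, a \notin Z, b \notin Z & [&& adj u a, adj u b & adj a b]].

Lemma triangle_sym u a b : triangle u a b -> triangle u b a.
Proof.
case/and4P=> uZ aZ bZ /and3P[ua ub ab].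
by rewrite /triangle uZ aZ bZ ua ub adj_sym ab.
Qed.

(** If [f [set u; v]] is the sum of [h u] and [h v] on every edge, this is twice
    [h u]. *)
Definition charge u a b := f [set u; a] + f [set u; b] - f [set a; b].

Lemma charge_sym u a b : charge u a b = charge u b a.
Proof. by rewrite /charge (label_sym a b); ring. Qed.

Lemma charge_shared u a b b' :
  triangle u a b -> triangle u a b' -> charge u a b = charge u a b'.
Proof.
case/and4P=> uZ aZ bZ /and3P[ua ub ab] /and4P[_ _ b'Z /and3P[_ ub' ab']].
have := @balanced u a b b' uZ aZ (adj_neq ua).
rewrite !inE bZ b'Z ub ab ub' ab' => /(_ isT isT) E.
by rewrite /charge -!addrA E.
Qed.

(** Change one vertex of the triangle at a time, through a common neighbour of
    [u], [a] and [a']. *)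
Lemma charge_indep u a b a' b' :
  triangle u a b -> triangle u a' b' -> charge u a b = charge u a' b'.
Proof.
move=> t t'; have [|d dZ dP] := @common_nbr_list [:: u; a; a'].
  exact: (leq_trans _ (leqW r_ge3)).
case/and4P: (t) => uZ aZ bZ /and3P[ua ub ab].
case/and4P: (t') => _ a'Z b'Z /and3P[ua' ub' ab'].
have tad : triangle u a d by rewrite /triangle uZ aZ dZ ua !dP // !inE eqxx ?orbT.
have ta'd : triangle u a' d by rewrite /triangle uZ a'Z dZ ua' !dP // !inE eqxx ?orbT.
rewrite (charge_shared t tad) charge_sym.
rewrite (charge_shared (triangle_sym tad) (triangle_sym ta'd)) charge_sym.
exact: charge_shared ta'd t'.
Qed.

Definition potential u :=
  if [pick p : G * G | triangle u p.1 p.2] is Some p then charge u p.1 p.2 else 0.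

Lemma potentialE u a b : triangle u a b -> potential u = charge u a b.
Proof.
move=> t; rewrite /potential; case: pickP => [[a' b'] /= t'|/(_ (a, b))].
  exact: charge_indep.
by rewrite /= t.
Qed.

Lemma potential_edge u v : u \notin Z -> v \notin Z -> adj u v ->
  potential u + potential v = f [set u; v] *+ 2.
Proof.
move=> uZ vZ uv; have [|d dZ dP] := @common_nbr_list [:: u; v].
  exact: (leq_trans _ (leqW r_ge3)).
have ud : adj u d by apply: dP; rewrite inE eqxx.
have vd : adj v d by apply: dP; rewrite !inE eqxx orbT.
rewrite (@potentialE u v d) ?(@potentialE v u d) /triangle ?uZ ?vZ ?dZ ?uv ?ud ?vd //.
  by rewrite /charge (label_sym v u) mulr2n; ring.
by rewrite adj_sym uv.
Qed.

Hypothesis f_lab : edge_labelling f.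

Lemma label_cases u v : adj u v -> f [set u; v] = -1 \/ f [set u; v] = 1.
Proof. by move=> uv; apply: f_lab; apply: edge_mem. Qed.

Lemma potential_cases u : u \notin Z -> 
  [\/ potential u = -1, potential u = 1, potential u = -3 | potential u = 3].
Proof.
move=> uZ; have [|a aZ aP] := @common_nbr_list [:: u].
  exact: (leq_trans _ (leqW r_ge3)).
have [|b bZ bP] := @common_nbr_list [:: u; a].
  exact: (leq_trans _ (leqW r_ge3)).
have ua : adj u a by apply: aP; rewrite inE eqxx.
have ub : adj u b by apply: bP; rewrite !inE eqxx.
have ab : adj a b by apply: bP; rewrite !inE eqxx orbT.
rewrite (@potentialE u a b) /charge; last by rewrite /triangle uZ aZ bZ ua ub ab.
case: (label_cases ua) => ->; case: (label_cases ub) => ->;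
  case: (label_cases ab) => ->; rewrite ?opprK.
all: try by constructor 1.
all: try by constructor 2.
all: try by constructor 3.
all: by constructor 4.
Qed.

(** The possible potentials -3, -1, 1, 3 fall into the classes {-1, 3} and
    {1, -3}, exchanged by the sign [e]; adjacent vertices outside [Z] lie in
    the same class. *)
Definition on_side (e : int) u := e * potential u = -1 \/ e * potential u = 3.

Lemma on_side_nbr e u v : e = 1 \/ e = -1 -> u \notin Z -> v \notin Z -> adj u v ->
  on_side e u -> on_side e v.
Proof.
move=> eE uZ vZ uv; rewrite /on_side; have := potential_edge uZ vZ uv.
case: eE => ->; case: (potential_cases uZ) => ->; case: (potential_cases vZ) => ->;
  case: (label_cases uv) => -> // _ [] // _; first [by left | by right].
Qed.

Lemma common_side : exists e : int, (e = 1 \/ e = -1) /\ forall v, v \notin Z -> on_side e v.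
Proof.
have [|u uZ _] := @common_nbr_list [::]; first by [].
have [e eE eu] : exists2 e : int, e = 1 \/ e = -1 & on_side e u.
  rewrite /on_side; case: (potential_cases uZ) => ->.
  - by exists 1; [left | left].
  - by exists (-1); [right | left].
  - by exists (-1); [right | right].
  - by exists 1; [left | right].
exists e; split=> // v vZ.
have [|d dZ dP] := @common_nbr_list [:: u; v].
  exact: (leq_trans _ (leqW r_ge3)).
have ud : adj u d by apply: dP; rewrite inE eqxx.
have vd : adj v d by apply: dP; rewrite !inE eqxx orbT.
apply: (@on_side_nbr e d v) => //; first by rewrite adj_sym.
exact: on_side_nbr uZ dZ ud eu.
Qed.

(** Two adjacent vertices of potential 3 would need a label 3 on their edge, so
    these vertices are pairwise nonadjacent. *)
Lemma card_potential3 (e : int) : e = 1 \/ e = -1 ->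
  (#|[set v | ((v \notin Z) && (e * potential v == 3))%R]| <= D)%N.
Proof.
move=> eE; set P := [set v | _].
have [->|[p pP]] := set_0Vmem P; first by rewrite cards0.
have := degD p; have := cardsC [set v | adj p v]; rewrite /degree.
suff : (#|P| <= #|~: [set v | adj p v]|)%N.
  by move: #|_| #|_| #|_| #|_|; clear; lia.
apply/subset_leq_card/subsetP => v vP; rewrite !inE; apply/negP => pv.
move: pP vP; rewrite !inE => /andP[pZ /eqP pE] /andP[vZ /eqP vE].
have : e * (potential p + potential v) = 6 by rewrite mulrDr pE vE.
rewrite (potential_edge pZ vZ pv).
by case: eE => ->; case: (label_cases pv) => ->.
Qed.

(** Each vertex of [K] lies on [#|K|.-1] edges of [K], and twice the label of an
    edge is the sum of the potentials of its ends. *)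
Lemma clique_potential K : clique K -> K \subset ~: Z ->
  weight f K *+ 2 + \sum_(v in K) potential v = (\sum_(v in K) potential v) *+ #|K|.
Proof.
move: {2}#|K| (erefl #|K|) => n; elim: n K => [|n IHn] K cardK cK KZ.
  move/eqP: cardK; rewrite cards_eq0 => /eqP ->.
  rewrite big_set0 cards0 mulr0n addr0 /weight big1 ?mul0rn // => A.
  case/andP=> /edgesP[x [y [_ ->]]]; rewrite subset0 => /eqP E.
  by have := set21 x y; rewrite E inE.
have [x xK] : exists x, x \in K by apply/set0Pn; rewrite -card_gt0 cardK.
have KxK : K :\ x \subset K := subsetDl _ _.
have cardKx : #|K :\ x| = n by have := cardsD1 x K; rewrite xK cardK => -[].
have := IHn _ cardKx (cliqueS KxK cK) (subset_trans KxK KZ).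
have xadj : {in K :\ x, forall a, adj x a}.
  move=> a; rewrite in_setD1 => /andP[ax aK]; move/cliqueP: cK; apply=> //.
  by rewrite eq_sym.
have notZ v : v \in K -> v \notin Z by move/(subsetP KZ); rewrite inE.
have linkE : link f x (K :\ x) *+ 2 =
    potential x *+ n + \sum_(v in K :\ x) potential v.
  rewrite /link -sumrMnl -cardKx -sumr_const -big_split /=.
  apply: eq_bigr => a aKx; rewrite -potential_edge ?xadj ?notZ //.
  exact: (subsetP KxK).
have wE : weight f K = weight f (K :\ x) + link f x (K :\ x).
  by rewrite -{1}(setD1K xK) weight_setU1 // in_setD1 eqxx.
rewrite (big_setD1 x xK) /= wE cardK cardKx; move: linkE.
move: (\sum_(v in _) _) (weight _ _) (link _ _ _) (potential x) => S w l p.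
by rewrite (mulrSr _ n) (mulrnDl 2) (mulrnDl n) => -> <-; ring.
Qed.

(** With [P] the set of vertices of potential 3, up to sign, the potentials add up
    to [4 * #|P|] minus the number of vertices outside [Z]. *)
Lemma rigid_tiling_weight T : clique_tiling r T (~: Z) ->
  ((#|G| - #|Z|)%:Z - (4 * D)%:Z) * (r.-1)%:Z <= `|tiling_weight f T| *+ 2.
Proof.
move=> [pT cT].
have [e [eE eLow]] := common_side.
pose S := \sum_(v in ~: Z) potential v.
have tS : tiling_weight f T *+ 2 + S = S *+ r.
  have -> : S = \sum_(K in T) \sum_(v in K) potential v.
    case/and3P: pT => /eqP cov triv _.
    by rewrite /S -cov big_trivIset.
  rewrite /tiling_weight -!sumrMnl -big_split /=; apply: eq_bigr => K KT.
  have [cardK cK] := cT K KT; rewrite -cardK; apply: clique_potential => //.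
  exact: partitionS pT KT.
pose P := [set v | (v \notin Z) && (e * potential v == 3)].
have cardP : (#|P| <= D)%N := card_potential3 eE.
have cardZC : #|~: Z| = (#|G| - #|Z|)%N by rewrite cardsCs setCK.
have eS : e * S = (4 * #|P|)%:Z - (#|G| - #|Z|)%:Z.
  have -> : (4 * #|P|)%:Z = \sum_(v in ~: Z) (if e * potential v == 3 then 4 else 0).
    rewrite -big_mkcondr /= sumr_const PoszM -[RHS]mulr_natr !natz; congr (_ * Posz _).
    by apply: eq_card => v; rewrite [RHS]unfold_in !inE.
  have -> : (#|G| - #|Z|)%:Z = \sum_(v in ~: Z) 1.
    by rewrite sumr_const -mulr_natr mul1r natz cardZC.
  rewrite /S mulr_sumr -sumrB; apply: eq_bigr => v; rewrite inE => /eLow.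
  by case=> ->.
have -> : `|tiling_weight f T| *+ 2 = `|e * S * r.-1%:Z|.
  have -> : e * S * r.-1%:Z = e * (tiling_weight f T *+ 2).
    rewrite -mulrA; congr (_ * _); apply: (addIr S); rewrite tS.
    by rewrite -{2}(prednK r_gt0) mulrSr -mulr_natr natz.
  by rewrite normrM normrMn; case: eE => ->; rewrite ?normrN normr1 mul1r.
rewrite eS normrM [X in _ <= _ * X]ger0_norm // ler_wpM2r //.
rewrite distrC; apply: le_trans (ler_norm _); rewrite lerD2l lerN2 lez_nat.
by rewrite leq_mul2l.
Qed.
End Rigid.
End Gadgets.

(** * The choice of constants *)

(** Here [p] stands for [2 ^ r], a bound for the number of edges of an [r]-clique,
    and [j] for the number of gadgets; [gap] is the minimum degree condition with
    [eta] replaced by [1 / q]. *)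
Section Arithmetic.
Variables n r q D j p : nat.
Hypothesis q_gt0 : (0 < q)%N.
Hypothesis r_ge3 : (3 <= r)%N.
Hypothesis n_gt0 : (0 < n)%N.
Hypothesis gap : (q * (r.+1 * D) + r.+1 * n <= q * n)%N.
Hypothesis j_small : (j * (2 * q * (r + p)) <= n)%N.

Lemma block_small : (q * (2 * r * j) <= n)%N.
Proof.
apply: leq_trans j_small; have -> : (q * (2 * r * j) = j * (2 * q * r))%N by ring.
by rewrite !leq_mul2l leq_addr !orbT.
Qed.

Lemma tiling_room : (r * D <= n - 2 * r * j)%N.
Proof.
have h := block_small.
rewrite -(leq_pmul2l q_gt0) mulnBr; nia.
Qed.

Lemma extension_room : (q * r <= n)%N -> (2 * r * j + r + r.+1 * D < n)%N.
Proof.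
move=> qr; have h := block_small.
have r4 : (4 * n <= r.+1 * n)%N by rewrite leq_mul2r ltnS r_ge3 orbT.
rewrite -(ltn_pmul2l q_gt0) (mulnDr q (2 * r * j + r)%N (r.+1 * D)%N).
rewrite (mulnDr q (2 * r * j)%N r); move: gap r4 h qr n_gt0.
move: (q * (r.+1 * D))%N (r.+1 * n)%N (q * n)%N (q * (2 * r * j))%N (q * r)%N.
by clear; lia.
Qed.

(** [w0] is the weight of the rigid part and [w1] that of the tiling of [Z], which
    consists of [2 * j] cliques. *)
Lemma rigid_bound (w0 w1 w : int) : w = w1 + w0 ->
  ((n - 2 * r * j)%:Z - (4 * D)%:Z) * r.-1%:Z <= `|w0| *+ 2 ->
  `|w1| <= (p * (2 * j))%:Z -> n%:Z <= q%:Z * `|w|.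
Proof.
move=> wE le0 le1.
have le_w : `|w0| <= `|w| + `|w1|.
  by have -> : w0 = w - w1; [rewrite wE; ring | apply: ler_normB].
have gap4 : (4 * (q * D) + 4 * n <= q * n)%N.
  have : (r.+1 * (q * D + n) <= q * n)%N by move: gap; lia.
  by apply: leq_trans; rewrite -mulnDr leq_mul2r; lia.
have h := block_small.
have hZ : (2 * r * j <= n)%N by nia.
have pos : 0 <= (n - 2 * r * j)%:Z - (4 * D)%:Z by nia.
have le2 : (n - 2 * r * j)%:Z - (4 * D)%:Z <= `|w0|.
  have r1 : (2 : int) <= r.-1%:Z by lia.
  by move: le0 pos r1; move: (_ - _) (r.-1%:Z) => a b; rewrite mulr2n; nia.
have le3 : (n - 2 * r * j)%:Z - (4 * D)%:Z - (p * (2 * j))%:Z <= `|w|.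
  by move: le2 le_w le1; lia.
have q_ge0 : (0 : int) <= q%:Z by [].
have := ler_wpM2l q_ge0 le3; apply: le_trans; rewrite -subzn //.
have E : (j * (2 * q * (r + p)) = q * (2 * r * j) + q * (p * (2 * j)))%N by ring.
move: gap4 j_small; rewrite E => g4 js.
rewrite !mulrBr -!PoszM (mulnCA q 4).
move: (q * D)%N (q * n)%N (q * (2 * r * j))%N (q * (p * (2 * j)))%N g4 js.
by clear; lia.
Qed.

End Arithmetic.

Lemma swap_bound (n m L : nat) (w : int) : (0 < m)%N -> (n < m.+1 * L)%N ->
  m%:Z <= 2 * w -> n%:Z <= (4 * L)%N%:Z * w.
Proof.
move=> m_gt0 lt_n le_m; apply: (@le_trans _ _ (2 * m * L)%N%:Z); first by nia.
have -> : (4 * L)%N%:Z * w = (2 * L)%N%:Z * (2 * w) by rewrite !PoszM; ring.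
have -> : (2 * m * L)%N%:Z = (2 * L)%N%:Z * m%:Z by rewrite !PoszM; ring.
exact: ler_wpM2l.
Qed.

(** Let [n = #|G|], [L = 2 * q * (r + 2 ^ r)] and [m = n %/ L].  If there are [m]
    disjoint gadgets, the two extreme tilings differ by at least [m]; if fewer
    of them form a maximal family, the rigid part dominates. *)
Theorem clique_tiling_discrepancy (G : sgraph) (r q D : nat) (f : {set G} -> int) :
  (3 <= r)%N -> (0 < q)%N -> (r %| #|G|)%N -> edge_labelling f ->
  (forall x : G, #|G| <= D + degree x)%N ->
  (q * (r.+1 * D) + r.+1 * #|G| <= q * #|G|)%N ->
  (2 * q * (r + 2 ^ r) <= #|G|)%N ->
  exists T : {set {set G}}, perfect_clique_tiling r T /\
    #|G|%:Z <= (4 * (2 * q * (r + 2 ^ r)))%N%:Z * `| \sum_(A in tiling_edges T) f A |.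
Proof.
move=> r_ge3 q_gt0 r_dvd f_lab degD gap.
set L := (2 * q * (r + 2 ^ r))%N => large; set n := #|G| in gap large *.
have r_gt0 : (0 < r)%N by apply: leq_trans r_ge3.
have L_gt0 : (0 < L)%N by rewrite !muln_gt0 q_gt0 addn_gt0 r_gt0.
have n_gt0 : (0 < n)%N := leq_trans L_gt0 large.
have [m [m_gt0 le_mn lt_nm]] :
    exists m, [/\ (0 < m)%N, (m * L <= n)%N & (n < m.+1 * L)%N].
  by exists (n %/ L)%N; rewrite divn_gt0 // leq_trunc_div ltn_ceil.
have [j [Z [T1 [T2 [[le_jm cardZ t1 t2 w12] alt]]]]] := disjoint_gadgets f r_gt0 m.
have j_small : (j * L <= n)%N.
  by apply: leq_trans le_mn; rewrite leq_mul2r le_jm orbT.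
have cardZC : #|~: Z| = (n - 2 * r * j)%N by rewrite cardsCs setCK cardZ.
have [||T0 t0] := @exists_clique_tiling G r D (~: Z) degD r_gt0.
- by rewrite cardZC dvdn_sub // -mulnA mulnCA dvdn_mulr.
- by rewrite cardZC; apply: tiling_room q_gt0 r_ge3 n_gt0 gap j_small.
have dZ : [disjoint Z & ~: Z] by rewrite -setI_eq0 setICr.
have [u1 wu1] := clique_tilingU f dZ t1 t0.
have [u2 wu2] := clique_tilingU f dZ t2 t0.
rewrite setUCr in u1 u2.
have sumE T : clique_tiling r T setT ->
    \sum_(A in tiling_edges T) f A = tiling_weight f T.
  by case=> pT _; apply: sum_tiling_edges pT.
have large_gap T : clique_tiling r T setT ->
    m%:Z <= 2 * `|tiling_weight f T| ->
    exists T, perfect_clique_tiling r T /\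
      n%:Z <= (4 * L)%N%:Z * `|\sum_(A in tiling_edges T) f A|.
  move=> tT le_m; exists T; split=> //; rewrite sumE //.
  exact: swap_bound m_gt0 lt_nm le_m.
case: alt => [jm|no_gadget]; last first.
  exists (T1 :|: T0); split=> //; rewrite sumE //.
  have room := extension_room q_gt0 r_ge3 n_gt0 gap j_small.
  have qr : (q * r <= n)%N.
    by apply: leq_trans large; rewrite /L; nia.
  have rigid := rigid_tiling_weight r_gt0 degD no_gadget r_ge3 _ f_lab t0.
  rewrite cardZ -/n in rigid; have {}rigid := rigid (room qr).
  have cardT1 : #|T1| = (2 * j)%N.
    apply/eqP; rewrite -(eqn_pmul2r r_gt0) -(card_clique_tiling t1) cardZ.
    by apply/eqP; ring.
  have w1 := abs_tiling_weight_le f_lab t1; rewrite cardT1 in w1.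
  have := rigid_bound q_gt0 r_ge3 n_gt0 gap j_small wu1 rigid w1.
  move/le_trans; apply; apply: ler_wpM2r => //.
  have -> : (4 * L = q * (8 * (r + 2 ^ r)))%N by rewrite /L; ring.
  by rewrite lez_nat leq_pmulr // muln_gt0 addn_gt0 r_gt0.
have : m%:Z <= `|tiling_weight f (T1 :|: T0)| + `|tiling_weight f (T2 :|: T0)|.
  have le_diff : m%:Z <= tiling_weight f (T1 :|: T0) - tiling_weight f (T2 :|: T0).
    move: w12; rewrite wu1 wu2 -jm.
    move: (tiling_weight f T1) (tiling_weight f T2) (tiling_weight f T0) => a b c.
    by rewrite opprD addrACA subrr addr0 lerBrDr addrC.
  exact: (le_trans le_diff (le_trans (ler_norm _) (ler_normB _ _))).
have [le12|/ltW le21] := lerP `|tiling_weight f (T1 :|: T0)|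
  `|tiling_weight f (T2 :|: T0)| => le_m.
  apply: (large_gap _ u2); apply: le_trans le_m _.
  by rewrite mulrDl mul1r lerD2r.
apply: (large_gap _ u1); apply: le_trans le_m _.
by rewrite mulrDl mul1r lerD2l.
Qed.

Lemma min_degree_le (G : sgraph) (x : G) : (min_degree G <= degree x)%N.
Proof.
rewrite /min_degree; have := mem_index_enum x.
elim: (index_enum G) => // y s IHs; rewrite in_cons big_cons geq_min.
by case/orP=> [/eqP <-|/IHs ->]; rewrite ?leqnn ?orbT.
Qed.

Lemma min_degree_le_card (G : sgraph) : (min_degree G <= #|G|)%N.
Proof.
rewrite /min_degree; elim/big_ind: _ => // [m n mG nG|x _].
  by rewrite geq_min mG.
by rewrite /degree max_card.
Qed.

(** The constants are [n0 = L] and [gamma = 1 / (4 * L)], where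
    [L = 2 * q * (r + 2 ^ r)] and [q] is a natural number above [1 / eta]. *)
Theorem theorem1p4 (R : realType) (r : nat) (eta : R) :
  (3 <= r)%N -> 0 < eta ->
  exists (n0 : nat) (gamma : R), 0 < gamma /\
    forall G : sgraph,
      (n0 <= #|G|)%N -> (r %| #|G|)%N ->
      (1 - 1 / r.+1%:R + eta) * #|G|%:R <= (min_degree G)%:R ->
      forall f : {set G} -> int, edge_labelling f ->
      exists T : {set {set G}}, perfect_clique_tiling r T /\
        gamma * #|G|%:R <= `| \sum_(A in tiling_edges T) f A |%:~R.
Proof.
move=> r_ge3 eta_gt0.
pose q := (Num.truncn eta^-1).+1.
have q_gt : 1 <= q%:R * eta.
  rewrite -ler_pdivrMr // mul1r; exact/ltW/truncnS_gt.
pose L := (2 * q * (r + 2 ^ r))%N.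
have L_gt0 : (0 < 4 * L)%N by rewrite !muln_gt0 addn_gt0 (leq_trans _ r_ge3).
exists L, (4 * L)%:R^-1; split; first by rewrite invr_gt0 ltr0n.
move=> G large r_dvd deg f f_lab.
pose D := (#|G| - min_degree G)%N.
have degD (x : G) : (#|G| <= D + degree x)%N.
  by rewrite addnC -leq_subLR leq_sub2l // min_degree_le.
have DE : D%:R = #|G|%:R - (min_degree G)%:R :> R.
  by rewrite natrB // min_degree_le_card.
have gap : (q * (r.+1 * D) + r.+1 * #|G| <= q * #|G|)%N.
  rewrite -(ler_nat R) natrD !natrM DE.
  have r_gt0 : 0 < r.+1%:R :> R by rewrite ltr0n.
  have d_le : r.+1%:R * (#|G|%:R - (min_degree G)%:R) <=
      #|G|%:R - r.+1%:R * (eta * #|G|%:R) :> R.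
    have := ler_wpM2l (ltW r_gt0) deg.
    have -> : r.+1%:R * ((1 - 1 / r.+1%:R + eta) * #|G|%:R) =
        r.+1%:R * #|G|%:R - #|G|%:R + r.+1%:R * (eta * #|G|%:R) :> R.
      by field; rewrite addrC natr1 gt_eqF.
    by rewrite mulrBr; lra.
  have eta_le : r.+1%:R * #|G|%:R <= q%:R * (r.+1%:R * (eta * #|G|%:R)) :> R.
    have -> : q%:R * (r.+1%:R * (eta * #|G|%:R)) =
        (q%:R * eta) * (r.+1%:R * #|G|%:R) :> R by ring.
    by rewrite ler_peMl // mulr_ge0.
  have := ler_wpM2l (ler0n R q) d_le; rewrite [in X in _ <= X]mulrBr.
  by move: eta_le; lra.
have [T [tT le]] := clique_tiling_discrepancy r_ge3 (ltn0Sn _ : (0 < q)%N)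
  r_dvd f_lab degD gap large.
exists T; split=> //.
rewrite ler_pdivrMl ?ltr0n //.
by rewrite -(ler_int R) intrM in le.
Qed.
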